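(* Let $L$ be a nondegenerate homogeneous linear pencil in $g$ variables and let $\tilde L$ be a minimal dimensional defining pencil for $\mathcal B_L$. If $\psi:\mathcal R_L\to\mathcal M_{\ell',\ell}$ is completely isometric, then there exist unitaries $U\in\mathbb C^{\ell'\times\ell'}$ and $V\in\mathbb C^{\ell\times\ell}$, nonnegative integers $m,m'$, and a completely contractive mapping $\phi:\mathcal R_{\tilde L}\to\mathcal M_{m',m}$ such that $$\psi(L(x))=U\begin{pmatrix}\tilde L(x)&0\\0&\phi(\tilde L(x))\end{pmatrix}V^*.$$
   Context: Pencils. A $d'\times d$ homogeneous linear pencil in $g$ variables is $L(x)=\sum_{j=1}^g A_jx_j$ with $A_j\in\mathbb C^{d'\times d}$. For $X=(X_1,\dots,X_g)\in(\mathbb C^{n\times n})^g$ put $L(X)=\sum_j A_j\otimes X_j$; $\|\cdot\|$ is the operator norm. $L$ is nondegenerate if for all $n$ and all $X\in(\mathbb C^{n\times n})^g$, $L(X)=0$ implies $X=0$. The pencil ball is $\mathcal B_L=(\mathcal B_L(n))_{n\in\mathbb N}$ with $\mathcal B_L(n)=\{X\in(\mathbb C^{n\times n})^g:\|L(X)\|<1\}$. A nondegenerate $p'\times p$ homogeneous linear pencil $\tilde L$ is a minimal dimensional defining pencil for a ball if every nondegenerate $d'\times d$ homogeneous linear pencil $L$ with $\mathcal B_L=\mathcal B_{\tilde L}$ satisfies $p'p\le d'd$; it is a minimal dimensional defining pencil for $\mathcal B_L$ if moreover $\mathcal B_{\tilde L}=\mathcal B_L$. Complete contractions. $\mathcal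 M_{\ell',\ell}=((\mathbb C^{n\times n})^{\ell'\times\ell})_{n\in\mathbb N}$. A subspace $F\subseteq\mathbb C^{d'\times d}$ is identified with the sequence $(F\otimes\mathbb C^{n\times n})_n$, written $F\le\mathcal M_{d',d}$. A linear map $\varphi:F\to\mathbb C^{\ell'\times\ell}$, written $\varphi:F\to\mathcal M_{\ell',\ell}$, induces $\varphi_n:F\otimes\mathbb C^{n\times n}\to\mathbb C^{\ell'\times\ell}\otimes\mathbb C^{n\times n}$, $\varphi_n(e\otimes Y)=\varphi(e)\otimes Y$. It is completely contractive (resp. completely isometric) if $\|\varphi_n(Z)\|\le\|Z\|$ (resp. $=\|Z\|$) for all $n$ and all $Z\in F\otimes\mathbb C^{n\times n}$. The range of $L$ is $\mathcal R_L=(\mathcal R_L(n))_n$ with $\mathcal R_L(n)=\{L(X):X\in(\mathbb C^{n\times n})^g\}$; that is, $\mathcal R_L=F\le\mathcal M_{d',d}$ for $F=\{L(x):x\in\mathbb C^g\}$. Blocks of size $0$ are allowed: if $m=0$ and/or $m'=0$ the corresponding block columns and/or rows are absent. *)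

(* Defs.v *)
(* MathComp / MathComp-Analysis.  The field of complex numbers is [R[i]] for an
   arbitrary [R : realType]; the tensor product of matrices is the Kronecker
   product [*t] of mathcomp.real_closed.mxtens. *)
From HB Require Import structures.
From mathcomp Require Import all_boot all_order all_algebra.
From mathcomp.classical Require Import all_classical.
From mathcomp Require Import reals.
From mathcomp.real_closed Require Import complex mxtens.

Set Implicit Arguments.
Unset Strict Implicit.
Unset Printing Implicit Defensive.

Import Order.TTheory GRing.Theory Num.Theory.
Local Open Scope classical_set_scope.
Local Open Scope ring_scope.

Definition l2norm (R : realType) (k : nat) (v : 'cV[R[i]]_k) : R :=
  Num.sqrt (\sum_i Normc.normc (v i ord0) ^+ 2).

(* When [k = 0] or [h = 0] the supremum is that of the set {0}. *)
Definition opnorm (R : realType) (h k : nat) (A : 'M[R[i]]_(h, k)) : R :=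
  sup [set r : R | exists2 v : 'cV[R[i]]_k, l2norm v <= 1 & r = l2norm (A *m v)].

(* The supremum defining [opnorm] is never the junk value of [sup]. *)
Lemma opnorm_has_sup (R : realType) (h k : nat) (A : 'M[R[i]]_(h, k)) :
  has_sup [set r : R | exists2 v : 'cV[R[i]]_k, l2norm v <= 1
                                              & r = l2norm (A *m v)].
Proof.
split.
  exists (l2norm (A *m 0)), 0 => //.
  rewrite /l2norm big1 ?sqrtr0 // => j _.
  by rewrite mxE Normc.normc0 expr0n.
have nge0 (z : R[i]) : 0 <= Normc.normc z by case: z => a b; exact: sqrtr_ge0.
exists (Num.sqrt (\sum_i (\sum_j Normc.normc (A i j)) ^+ 2)) => _ [v v1 ->].
have vj j : Normc.normc (v j ord0) <= 1.
  apply: le_trans v1; rewrite -[leLHS]ger0_norm // -sqrtr_sqr ler_wsqrtr //.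
  by rewrite (bigD1 j) //= lerDl sumr_ge0 // => i _; rewrite exprn_ge0.
apply: ler_wsqrtr; apply: ler_sum => i _.
rewrite lerXn2r ?nnegrE ?sumr_ge0 // mxE.
have : Normc.normc (\sum_j A i j * v j ord0)
    <= \sum_j Normc.normc (A i j * v j ord0).
  elim/big_ind2: _ => [|x1 x2 y1 y2 hx hy|//]; first by rewrite Normc.normc0.
  by apply: le_trans (lerD hx hy); exact: le_normcD.
move/le_trans; apply; apply: ler_sum => j _.
by rewrite Normc.normcM ler_piMr.
Qed.

Definition pencil (R : realType) (g d' d : nat) : Type :=
  'I_g -> 'M[R[i]]_(d', d).

Definition mxeval (R : realType) (g d' d : nat) (L : pencil R g d' d) (n : nat)
    (X : 'I_g -> 'M[R[i]]_n) : 'M[R[i]]_(d' * n, d * n) :=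
  \sum_j L j *t X j.

Definition peval (R : realType) (g d' d : nat) (L : pencil R g d' d)
    (x : 'rV[R[i]]_g) : 'M[R[i]]_(d', d) :=
  \sum_j x ord0 j *: L j.

Definition nondegenerate_pencil (R : realType) (g d' d : nat)
    (L : pencil R g d' d) : Prop :=
  forall (n : nat) (X : 'I_g -> 'M[R[i]]_n),
    mxeval L X = 0 -> forall j, X j = 0.

Definition pencil_ball (R : realType) (g d' d : nat) (L : pencil R g d' d) (n : nat) :
    set ('I_g -> 'M[R[i]]_n) :=
  [set X | opnorm (mxeval L X) < 1].
Arguments pencil_ball {R g d' d} L n _.

Definition same_ball (R : realType) (g d' d e' e : nat)
    (L : pencil R g d' d) (K : pencil R g e' e) : Prop :=
  forall n : nat, pencil_ball L n = pencil_ball K n.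

Definition minimal_pencil (R : realType) (g p' p : nat)
    (Lt : pencil R g p' p) : Prop :=
  nondegenerate_pencil Lt /\
  forall (d' d : nat) (L : pencil R g d' d),
    nondegenerate_pencil L -> same_ball L Lt -> (p' * p <= d' * d)%N.

Definition minimal_pencil_for (R : realType) (g d' d p' p : nat)
    (L : pencil R g d' d) (Lt : pencil R g p' p) : Prop :=
  minimal_pencil Lt /\ same_ball Lt L.

Lemma peval_is_linear (R : realType) (g d' d : nat) (L : pencil R g d' d) :
  linear (peval L).
Proof.
move=> c x y; rewrite /peval scaler_sumr -big_split /=.
by apply: eq_bigr => j _; rewrite !mxE scalerDl scalerA.
Qed.

HB.instance Definition _ (R : realType) (g d' d : nat) (L : pencil R g d' d) :=
  GRing.isLinear.Build R[i] 'rV[R[i]]_g 'M[R[i]]_(d', d) _ (peval L)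
    (peval_is_linear L).

Definition prange (R : realType) (g d' d : nat) (L : pencil R g d' d) :
    {vspace 'M[R[i]]_(d', d)} :=
  limg (linfun (peval L)).

Lemma peval_in_prange (R : realType) (g d' d : nat) (L : pencil R g d' d)
    (x : 'rV[R[i]]_g) : peval L x \in prange L.
Proof. by rewrite -(lfunE (peval L)) memv_img ?memvf. Qed.

(* [peval L x] as an element of its range. *)
Definition rpeval (R : realType) (g d' d : nat) (L : pencil R g d' d)
    (x : 'rV[R[i]]_g) : subvs_of (prange L) :=
  Subvs (peval_in_prange L x).

Definition in_tensor (R : realType) (d' d : nat)
    (F : {vspace 'M[R[i]]_(d', d)}) (n : nat) :
    set 'M[R[i]]_(d' * n, d * n) :=
  [set Z | exists (k : nat) (e : 'I_k -> subvs_of F) (Y : 'I_k -> 'M[R[i]]_n),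
     Z = \sum_i vsval (e i) *t Y i].
Arguments in_tensor {R d' d} F n _.

(* The matrix coefficient of [delta_mx a b] in [Z], that is, the [Z_ab] such
   that [Z = \sum_(a, b) Z_ab *t delta_mx a b]. *)
Definition tcoef (R : realType) (d' d n : nat) (Z : 'M[R[i]]_(d' * n, d * n))
    (a b : 'I_n) : 'M[R[i]]_(d', d) :=
  \matrix_(i, j) Z (mxtens_index (i, a)) (mxtens_index (j, b)).

(* The induced map on [F (x) M_n]; its values at [Z] not in [in_tensor F n] are
   junk.  The defining property is [ampl_tens] below. *)
Definition ampl (R : realType) (d' d l' l : nat)
    (F : {vspace 'M[R[i]]_(d', d)})
    (phi : {linear subvs_of F -> 'M[R[i]]_(l', l)}) (n : nat)
    (Z : 'M[R[i]]_(d' * n, d * n)) : 'M[R[i]]_(l' * n, l * n) :=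
  \sum_a \sum_b phi (vsproj F (tcoef Z a b)) *t delta_mx a b.

Lemma ampl_is_linear (R : realType) (d' d l' l : nat)
    (F : {vspace 'M[R[i]]_(d', d)})
    (phi : {linear subvs_of F -> 'M[R[i]]_(l', l)}) (n : nat) :
  linear (@ampl R d' d l' l F phi n).
Proof.
move=> c Z W; rewrite /ampl scaler_sumr -big_split /=; apply: eq_bigr => a _.
rewrite scaler_sumr -big_split /=; apply: eq_bigr => b _.
have -> : tcoef (c *: Z + W) a b = c *: tcoef Z a b + tcoef W a b.
  by apply/matrixP => i j; rewrite !mxE.
rewrite !linearP /=; apply/matrixP => i j.
by rewrite !(mxE, tensmxE) mulrDl mulrA.
Qed.

Lemma ampl_tens (R : realType) (d' d l' l : nat)
    (F : {vspace 'M[R[i]]_(d', d)})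
    (phi : {linear subvs_of F -> 'M[R[i]]_(l', l)}) (n : nat)
    (e : subvs_of F) (Y : 'M[R[i]]_n) :
  ampl phi (vsval e *t Y) = phi e *t Y.
Proof.
rewrite [in RHS](matrix_sum_delta Y) /ampl.
have tE (M : 'M[R[i]]_(l', l)) (I : finType) (G : I -> 'M[R[i]]_n) :
    M *t (\sum_i G i) = \sum_i M *t G i.
  apply/matrixP => i j; rewrite [RHS]summxE !mxE summxE mulr_sumr.
  by apply: eq_bigr => k _; rewrite mxE.
rewrite tE; apply: eq_bigr => a _; rewrite tE; apply: eq_bigr => b _.
have -> : tcoef (vsval e *t Y) a b = Y a b *: vsval e.
  by apply/matrixP => i j; rewrite mxE tensmxE mxE mulrC.
rewrite !linearZ /= vsvalK; apply/matrixP => i j.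
by rewrite !mxE; rewrite mulrCA mulrA.
Qed.

Definition completely_contractive (R : realType) (d' d l' l : nat)
    (F : {vspace 'M[R[i]]_(d', d)})
    (phi : {linear subvs_of F -> 'M[R[i]]_(l', l)}) : Prop :=
  forall (n : nat) (Z : 'M[R[i]]_(d' * n, d * n)),
    in_tensor F n Z -> opnorm (ampl phi Z) <= opnorm Z.

Definition completely_isometric (R : realType) (d' d l' l : nat)
    (F : {vspace 'M[R[i]]_(d', d)})
    (phi : {linear subvs_of F -> 'M[R[i]]_(l', l)}) : Prop :=
  forall (n : nat) (Z : 'M[R[i]]_(d' * n, d * n)),
    in_tensor F n Z -> opnorm (ampl phi Z) = opnorm Z.

(* Main.v *)
(** Put K_j := psi (L_j), so that ||K(X)|| = ||L(X)|| = ||Lt(X)|| for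
    every X. A separation argument for the cone of sums of quadratic maps gives
    a finite-dimensional Haagerup-Paulsen-Wittstock factorization: whenever
    ||A(X)|| <= ||K(X)|| for all X, one has A_j = sum_i W'_i^* K_j W_i with
    sum_i W_i^* W_i <= 1 and sum_i W'_i^* W'_i <= 1. Apply it from Lt to K
    (families W, W') and from K to Lt (families V, V').

    Among the representations Lt_j = sum_i Y'_i^* Lt_j Y_i choose one maximizing
    sum |Lt_j Y_i|^2; it exists by compactness. By the Schwarz inequality,
    passing from Y to the composite V W Y does not decrease this quantity, so
    the defects D = K_j W_a - W'_a Lt_j satisfy D Y_i = 0. By minimality of Lt
    the ranges of the Y_i span (otherwise Lt could be compressed to a smaller
    space), so D = 0: every pair (W_a, W'_a) intertwines Lt and K, and dually
    their adjoints.

    An intertwiner T : Lt -> K of maximal rank is injective. If Q is the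
    projection onto its kernel, some S = W_a Q is nonzero; T^* S commutes with Lt
    and squares to zero, and minimality leaves no nilpotents in the commutant of
    Lt. Hence T^* S = 0 and T + S has larger rank. The isometry
    T (T^* T)^{-1/2} then identifies Lt with a direct summand of K, and phi is
    the compression of psi to the orthogonal complement. *)

Require Import Defs.
From mathcomp Require Import all_boot all_order all_algebra.
From mathcomp Require Import spectral sesquilinear reals.
From mathcomp.real_closed Require Import complex.
From HB Require Import structures.
From mathcomp.real_closed Require Import mxtens.
From mathcomp.classical Require Import boolp classical_sets.
From mathcomp.analysis Require Import topology normedtype derive.
From mathcomp Require Import ring lra.

Set Implicit Arguments.
Unset Strict Implicit.
Unset Printing Implicit Defensive.

Import Order.TTheory GRing.Theory Num.Theory.
Import numFieldNormedType.Exports.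

Local Open Scope ring_scope.
Local Open Scope sesquilinear_scope.

Local Notation Re := complex.Re.
Local Notation Im := complex.Im.
Local Notation normc := Normc.normc.

(** * Positive matrices and functional calculus *)

Section PositiveMatrices.
Variable C : numClosedFieldType.

Lemma adjE m n (A : 'M[C]_(m, n)) i j : (A^t* ) i j = (A j i)^*.
Proof. by rewrite !mxE. Qed.

Lemma adjM m n k (A : 'M[C]_(m, n)) (B : 'M[C]_(n, k)) :
  (A *m B)^t* = B^t* *m A^t*.
Proof. by rewrite trmx_mul map_mxM. Qed.

Lemma adjD m n (A B : 'M[C]_(m, n)) : (A + B)^t* = A^t* + B^t*.
Proof. by rewrite raddfD map_mxD. Qed.

Lemma adjB m n (A B : 'M[C]_(m, n)) : (A - B)^t* = A^t* - B^t*.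
Proof. by rewrite raddfB map_mxB. Qed.

Lemma adjZ m n c (A : 'M[C]_(m, n)) : (c *: A)^t* = c^* *: A^t*.
Proof. by rewrite linearZ map_mxZ. Qed.

Lemma adj0 m n : (0 : 'M[C]_(m, n))^t* = 0.
Proof. by rewrite trmx0 map_mx0. Qed.

Lemma adj1 n : (1%:M : 'M[C]_n)^t* = 1%:M.
Proof. by rewrite trmx1 map_mx1. Qed.

Lemma adj_sum m n (J : finType) (A : J -> 'M[C]_(m, n)) :
  (\sum_i A i)^t* = \sum_i (A i)^t*.
Proof. by rewrite raddf_sum raddf_sum. Qed.

Lemma mxtrace_adj n (A : 'M[C]_n) : \tr (A^t* ) = (\tr A)^*.
Proof. by rewrite /mxtrace rmorph_sum; apply: eq_bigr => i _; rewrite !mxE. Qed.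

Definition hs m n (A : 'M[C]_(m, n)) : C := \tr (A^t* *m A).

Lemma hsE m n (A : 'M[C]_(m, n)) : hs A = \sum_i \sum_j `|A i j| ^+ 2.
Proof.
rewrite exchange_big /hs /mxtrace; apply: eq_bigr => i _ /=.
by rewrite mxE; apply: eq_bigr => j _; rewrite adjE normCK mulrC.
Qed.

Lemma hs_ge0 m n (A : 'M[C]_(m, n)) : 0 <= hs A.
Proof. by rewrite hsE; do 2!apply: sumr_ge0 => ? _; rewrite exprn_ge0. Qed.

Lemma hs_eq0 m n (A : 'M[C]_(m, n)) : hs A = 0 -> A = 0.
Proof.
rewrite hsE => A0; apply/matrixP => i j; rewrite mxE; apply/eqP.
have nn (k : 'I_m) : true -> 0 <= \sum_j `|A k j| ^+ 2.
  by move=> _; apply: sumr_ge0 => ? _; rewrite exprn_ge0.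
have /eqP := psumr_eq0P nn A0 (i:=i) isT.
rewrite psumr_eq0 => [/allP /(_ j (mem_index_enum _))|k _]; last exact: exprn_ge0.
by rewrite /= expf_eq0 /= normr_eq0.
Qed.

Lemma hs0 m n : hs (0 : 'M[C]_(m, n)) = 0.
Proof. by rewrite /hs mulmx0 mxtrace0. Qed.

Lemma hs_adj m n (A : 'M[C]_(m, n)) : hs (A^t* ) = hs A.
Proof. by rewrite /hs trmxCK mxtrace_mulC. Qed.

Lemma gram_sub m n (P Q : 'M[C]_(m, n)) :
  (P - Q)^t* *m (P - Q) = P^t* *m P - Q^t* *m P - P^t* *m Q + Q^t* *m Q.
Proof.
rewrite adjB mulmxBl !mulmxBr opprB addrA [LHS]addrAC; congr (_ + _).
by rewrite addrAC.
Qed.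

Lemma hs_sub m n (P Q : 'M[C]_(m, n)) :
  hs (P - Q) = hs P - \tr (Q^t* *m P) - \tr (P^t* *m Q) + hs Q.
Proof. by rewrite /hs gram_sub raddfD /= !raddfB. Qed.

(** The height of the factor is left free, so that sums are obtained by stacking factors;
    [psd_of_form] and [psd_sqrt] connect this with nonnegative quadratic forms and square
    factors. *)
Definition psd n (H : 'M[C]_n) : Prop :=
  exists m (R : 'M[C]_(m, n)), H = R^t* *m R.

Lemma psd0 n : psd (0 : 'M[C]_n).
Proof. by exists n, 0; rewrite mulmx0. Qed.

Lemma psd_gram m n (R : 'M[C]_(m, n)) : psd (R^t* *m R).
Proof. by exists m, R. Qed.

Lemma psdD n (H K : 'M[C]_n) : psd H -> psd K -> psd (H + K).
Proof.
move=> [m [R ->]] [k [S ->]]; exists (m + k)%N, (col_mx R S).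
by rewrite tr_col_mx map_row_mx mul_row_col.
Qed.

Lemma psd_sum n (J : finType) (H : J -> 'M[C]_n) :
  (forall i, psd (H i)) -> psd (\sum_i H i).
Proof. by move=> psdH; elim/big_ind: _ => //; [exact: psd0|exact: psdD]. Qed.

Lemma psd_conj m n (H : 'M[C]_n) (A : 'M[C]_(n, m)) :
  psd H -> psd (A^t* *m H *m A).
Proof.
by move=> [k [R ->]]; exists k, (R *m A); rewrite adjM !mulmxA.
Qed.

Lemma psd_adj n (H : 'M[C]_n) : psd H -> H^t* = H.
Proof. by move=> [m [R ->]]; rewrite adjM trmxCK. Qed.

Lemma psd_trace_ge0 n (H : 'M[C]_n) : psd H -> 0 <= \tr H.
Proof. by move=> [m [R ->]]; exact: hs_ge0. Qed.

Definition fcalc (f : C -> C) n (H : 'M[C]_n) : 'M[C]_n :=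
  (spectralmx H)^t* *m diag_mx (map_mx f (spectral_diag H)) *m spectralmx H.

Lemma spectral_adjK n (H : 'M[C]_n) : spectralmx H *m (spectralmx H)^t* = 1%:M.
Proof. exact/unitarymxP/spectral_unitarymx. Qed.

Lemma spectral_Kadj n (H : 'M[C]_n) : (spectralmx H)^t* *m spectralmx H = 1%:M.
Proof. exact/mulmx1C/spectral_adjK. Qed.

Lemma fcalc_id n (H : 'M[C]_n) : H^t* = H -> fcalc id H = H.
Proof.
move=> hH; rewrite /fcalc (@map_mx_id _ _ _ id) // -invmx_unitary ?spectral_unitarymx //.
by apply/esym/orthomx_spectralP/normalmxP; rewrite hH.
Qed.

Lemma fcalcM f h n (H : 'M[C]_n) :
  fcalc f H *m fcalc h H = fcalc (fun x => f x * h x) H.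
Proof.
rewrite /fcalc !mulmxA; congr (_ *m _).
rewrite -[_ *m spectralmx H *m _]mulmxA spectral_adjK mulmx1.
rewrite -!mulmxA mulmx_diag; congr (_ *m _); congr diag_mx.
by apply/rowP => i; rewrite !mxE.
Qed.

(** In eigenbases of [H] and [K] the hypothesis makes an entry of [X] vanish unless its row and
    column eigenvalues agree, and then [f] takes the same value on both. Hence [f] may be
    arbitrary. *)
Lemma fcalc_intertwine f m n (H : 'M[C]_m) (K : 'M[C]_n) (T : 'M[C]_(m, n)) :
  H^t* = H -> K^t* = K -> H *m T = T *m K -> fcalc f H *m T = T *m fcalc f K.
Proof.
move=> hH hK; rewrite -{1}(fcalc_id hH) -{1}(fcalc_id hK).
rewrite /fcalc !(@map_mx_id _ _ _ id) //.
set U := spectralmx H; set V := spectralmx K.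
set d := spectral_diag H; set e := spectral_diag K => HT.
pose X := U *m T *m V^t*.
have dX : diag_mx d *m X = X *m diag_mx e.
  move/(congr1 (fun Y => U *m Y *m V^t* )): HT.
  by rewrite /X !mulmxA spectral_adjK mul1mx -!mulmxA spectral_adjK mulmx1 !mulmxA.
have fX : diag_mx (map_mx f d) *m X = X *m diag_mx (map_mx f e).
  apply/matrixP => i j; move/matrixP/(_ i j): dX.
  rewrite !mul_diag_mx !mul_mx_diag !mxE.
  have [->|] := eqVneq (d 0 i) (e 0 j); first by move=> _; rewrite mulrC.
  move=> de /eqP; rewrite [X in _ == X]mulrC -subr_eq0 -mulrBl mulf_eq0 subr_eq0.
  by rewrite (negPf de) /= => /eqP ->; rewrite mulr0 mul0r.
move/(congr1 (fun Y => U^t* *m Y *m V)): fX.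
rewrite /X !mulmxA.
rewrite -[_ *m V^t* *m V]mulmxA spectral_Kadj mulmx1 => ->.
by rewrite spectral_Kadj mul1mx.
Qed.

Lemma spectral_diag_ge0 n (H : 'M[C]_n) : H^t* = H ->
  (forall v : 'cV[C]_n, 0 <= (v^t* *m H *m v) 0 0) ->
  forall i, 0 <= spectral_diag H 0 i.
Proof.
move=> hH posH i; have := posH ((spectralmx H)^t* *m delta_mx i 0).
set P := spectralmx H; set v := P^t* *m _.
have Pv : P *m v = delta_mx i 0 by rewrite mulmxA spectral_adjK mul1mx.
have -> : v^t* *m H *m v = (P *m v)^t* *m diag_mx (spectral_diag H) *m (P *m v).
  by rewrite -{1}(fcalc_id hH) /fcalc (@map_mx_id _ _ _ id) // adjM !mulmxA.
rewrite Pv trmx_delta map_delta_mx -rowE -colE !mxE eqxx mulr1n.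
by [].
Qed.

Lemma psd_of_form n (H : 'M[C]_n) : H^t* = H ->
  (forall v : 'cV[C]_n, 0 <= (v^t* *m H *m v) 0 0) ->
  exists R : 'M[C]_n, H = R^t* *m R.
Proof.
move=> hH posH; have d0 := spectral_diag_ge0 hH posH.
exists (diag_mx (map_mx sqrtC (spectral_diag H)) *m spectralmx H).
rewrite adjM tr_diag_mx map_diag_mx.
rewrite !mulmxA -[_ *m diag_mx _ *m diag_mx _]mulmxA mulmx_diag.
rewrite -{1}(fcalc_id hH) /fcalc; congr (_ *m diag_mx _ *m _).
apply/rowP => i; rewrite !mxE /= conj_Creal ?ger0_real ?sqrtC_ge0 //.
by rewrite -expr2 sqrtCK.
Qed.

Lemma psd_form_ge0 n (H : 'M[C]_n) (v : 'cV[C]_n) :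
  psd H -> 0 <= (v^t* *m H *m v) 0 0.
Proof.
move=> /(psd_conj v) /psd_trace_ge0.
by rewrite /mxtrace big_ord1.
Qed.

(** Trading a factor of any height for a square one is what bounds the number of vectors in
    [qfam_reduce]. *)
Lemma psd_sqrt n (H : 'M[C]_n) : psd H -> exists R : 'M[C]_n, H = R^t* *m R.
Proof.
by move=> pH; apply: psd_of_form (psd_adj pH) _ => v; exact: psd_form_ge0.
Qed.

Fact isqrt_key : unit. Proof. by []. Qed.

(* The inverse square root of [H] on its range, and [0] on its kernel. *)
Definition isqrt n (H : 'M[C]_n) : 'M[C]_n :=
  locked_with isqrt_key (fcalc (fun x => (sqrtC x)^-1) H).

Lemma isqrt_adj n (H : 'M[C]_n) : psd H -> (isqrt H)^t* = isqrt H.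
Proof.
move=> pH; rewrite /isqrt unlock /fcalc !adjM trmxCK mulmxA tr_diag_mx map_diag_mx.
congr (_ *m diag_mx _ *m _); apply/rowP => i; rewrite !mxE.
rewrite /= conj_Creal // ger0_real // invr_ge0 sqrtC_ge0.
apply: spectral_diag_ge0 (psd_adj pH) _ _ => v; exact: psd_form_ge0.
Qed.

Lemma isqrt_intertwine m n (H : 'M[C]_m) (K : 'M[C]_n) (T : 'M[C]_(m, n)) :
  psd H -> psd K -> H *m T = T *m K -> isqrt H *m T = T *m isqrt K.
Proof. by rewrite /isqrt !unlock => /psd_adj hH /psd_adj hK; exact: fcalc_intertwine. Qed.

Lemma isqrt_comm n (H : 'M[C]_n) : psd H -> isqrt H *m H = H *m isqrt H.
Proof. by move=> pH; exact: isqrt_intertwine. Qed.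

(** On an eigenvalue [x] this reads [x^-1 * x * x = x], which survives at [x = 0] because
    [0^-1 = 0]. *)
Lemma isqrtK n (H : 'M[C]_n) : psd H -> isqrt H *m isqrt H *m H *m H = H.
Proof.
move=> pH; rewrite -{3 4 5}(fcalc_id (psd_adj pH)) /isqrt unlock !fcalcM.
rewrite /fcalc; congr (_ *m diag_mx _ *m _); apply/rowP => i; rewrite !mxE.
rewrite -invfM -expr2 sqrtCK; set x := spectral_diag H 0 i.
by have [->|x0] := eqVneq x 0; rewrite ?mulr0 // mulVf // mul1r.
Qed.

End PositiveMatrices.

(** * Quadratic forms and semidefinite separation *)

Section ComplexReal.
Variable R : realType.
Implicit Types (z : R[i]) (r : R).

Lemma conjCE z : z^* = (Re z -i* Im z)%C.
Proof. by case: z. Qed.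

Lemma ReD z1 z2 : Re (z1 + z2) = Re z1 + Re z2.
Proof. by case: z1; case: z2. Qed.

Lemma ReN z : Re (- z) = - Re z.
Proof. by case: z. Qed.

Lemma ReB z1 z2 : Re (z1 - z2) = Re z1 - Re z2.
Proof. by rewrite ReD ReN. Qed.

Lemma Re_real r z : Re (r%:C%C * z) = r * Re z.
Proof. by case: z => a b /=; rewrite mul0r subr0. Qed.

Lemma Re_sum (J : finType) (F : J -> R[i]) : Re (\sum_i F i) = \sum_i Re (F i).
Proof. by elim/big_rec2: _ => // i y1 y2 _ <-; rewrite ReD. Qed.

Lemma cRe_conj z : Re z^* = Re z.
Proof. by case: z. Qed.

Lemma ler_Re z1 z2 : z1 <= z2 -> Re z1 <= Re z2.
Proof. by rewrite lecE => /andP[]. Qed.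

Lemma conjC_realC r : (r%:C%C : R[i])^* = r%:C%C.
Proof. by rewrite conjCE /= oppr0. Qed.

Lemma ge0_realC z : 0 <= z -> z = (Re z)%:C%C.
Proof. by case: z => a b; rewrite lecE /= => /andP[/eqP -> _]. Qed.

Definition nsq z : R := Re z ^+ 2 + Im z ^+ 2.

Lemma nsq_ge0 z : 0 <= nsq z.
Proof. by rewrite addr_ge0 // sqr_ge0. Qed.

Lemma nsq_eq0 z : nsq z = 0 -> z = 0.
Proof.
case: z => a b; rewrite /nsq /= => /eqP.
by rewrite paddr_eq0 ?sqr_ge0 // !sqrf_eq0 => /andP[/eqP -> /eqP ->].
Qed.

Lemma nsqE z : nsq z = normc z ^+ 2.
Proof. by case: z => a b; rewrite /= sqr_sqrtr // addr_ge0 // sqr_ge0. Qed.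

Lemma normc_ge0 z : 0 <= normc z.
Proof. by case: z => a b; exact: sqrtr_ge0. Qed.

Lemma Re_le_normc z : Re z <= normc z.
Proof.
case: z => a b /=; apply: le_trans (ler_norm _) _; rewrite -sqrtr_sqr.
by rewrite ler_wsqrtr // lerDl sqr_ge0.
Qed.

Lemma Re_mulC z : Re (z * z^*) = nsq z.
Proof. by case: z => a b; rewrite conjCE /nsq /=; ring. Qed.

Lemma nsq_sub_scale r z1 z2 :
  nsq (z1 - r%:C%C * z2) = nsq z1 - r * (2 * Re (z1^* * z2)) + r ^+ 2 * nsq z2.
Proof. by case: z1 z2 => a b [c d]; rewrite conjCE /nsq /=; ring. Qed.

(** First-order optimality: divide by [s] and let [s] tend to 0. *)
Lemma le0_small (x y : R) :
  (forall s, 0 < s -> s < 1 -> s * x <= s ^+ 2 * y) -> x <= 0.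
Proof.
move=> xy; rewrite leNgt; apply/negP => x0.
have y0 : 0 <= `|y| by [].
(* This [s] lies strictly between 0 and 1 and satisfies [s * |y| < x], which contradicts
   [x <= s * y]. *)
pose s := x / (2 * (x + `|y| + 1)).
have d0 : 0 < 2 * (x + `|y| + 1) by lra.
have s0 : 0 < s by rewrite divr_gt0.
have s1 : s < 1 by rewrite ltr_pdivrMr //; lra.
have := xy s s0 s1; rewrite expr2 -mulrA ler_pM2l //.
have : s * y <= s * `|y| by rewrite ler_pM2l // ler_norm.
have : s * `|y| < x.
  by rewrite /s mulrAC ltr_pdivrMr // ltr_pM2l //; lra.
by lra.
Qed.

End ComplexReal.

(** * Compactness and minima over complex matrices *)

Section CompactMinimum.
Variable R : realType.

(** Continuity is split into real coordinates because the extreme value theorem is applied to real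
    functions on real row vectors. *)
Definition ccont n (F : 'rV[R]_n -> R[i]) : Prop :=
  continuous (fun x => Re (F x) : R^o) /\ continuous (fun x => Im (F x) : R^o).

Lemma contD n (f h : 'rV[R]_n -> R) :
  continuous (f : _ -> R^o) -> continuous (h : _ -> R^o) ->
  continuous (fun x => f x + h x : R^o).
Proof. by move=> cf ch x; apply: continuousD; [exact: cf|exact: ch]. Qed.

Lemma contN n (f : 'rV[R]_n -> R) :
  continuous (f : _ -> R^o) -> continuous (fun x => - f x : R^o).
Proof. by move=> cf x; apply: continuousN; exact: cf. Qed.

Lemma contM n (f h : 'rV[R]_n -> R) :
  continuous (f : _ -> R^o) -> continuous (h : _ -> R^o) ->
  continuous (fun x => f x * h x : R^o).
Proof. by move=> cf ch x; apply: continuousM; [exact: cf|exact: ch]. Qed.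

Lemma cont_sum n (J : finType) (f : J -> 'rV[R]_n -> R) :
  (forall i, continuous (f i : _ -> R^o)) ->
  continuous (fun x => \sum_i f i x : R^o).
Proof.
move=> cf; elim: (index_enum J) => [|j s IHs].
  by under eq_fun do rewrite big_nil; exact: cst_continuous.
by under eq_fun do rewrite big_cons; exact: contD.
Qed.

Lemma ccontD n (F G : 'rV[R]_n -> R[i]) :
  ccont F -> ccont G -> ccont (fun x => F x + G x).
Proof.
have eRe z1 z2 : Re (z1 + z2 : R[i]) = Re z1 + Re z2 by case: z1; case: z2.
have eIm z1 z2 : Im (z1 + z2 : R[i]) = Im z1 + Im z2 by case: z1; case: z2.
move=> [F1 F2] [G1 G2]; split.
  by under eq_fun do rewrite eRe; exact: contD.
by under eq_fun do rewrite eIm; exact: contD.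
Qed.

Lemma ccontM n (F G : 'rV[R]_n -> R[i]) :
  ccont F -> ccont G -> ccont (fun x => F x * G x).
Proof.
have eRe z1 z2 : Re (z1 * z2 : R[i]) = Re z1 * Re z2 - Im z1 * Im z2.
  by case: z1; case: z2.
have eIm z1 z2 : Im (z1 * z2 : R[i]) = Re z1 * Im z2 + Im z1 * Re z2.
  by case: z1; case: z2.
move=> [F1 F2] [G1 G2]; split.
  by under eq_fun do rewrite eRe; apply: contD; [|apply: contN]; exact: contM.
by under eq_fun do rewrite eIm; apply: contD; exact: contM.
Qed.

Lemma ccont_conj n (F : 'rV[R]_n -> R[i]) : ccont F -> ccont (fun x => (F x)^* ).
Proof.
move=> [F1 F2]; split; first by under eq_fun do rewrite conjCE.
by under eq_fun do rewrite conjCE; apply: contN.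
Qed.

Lemma ccont_cst n (c : R[i]) : ccont (fun _ : 'rV[R]_n => c).
Proof. by split; exact: cst_continuous. Qed.

Lemma ccont_sum n (J : finType) (F : J -> 'rV[R]_n -> R[i]) :
  (forall i, ccont (F i)) -> ccont (fun x => \sum_i F i x).
Proof.
move=> cf; elim: (index_enum J) => [|j s IHs].
  by under eq_fun do rewrite big_nil; exact: ccont_cst.
by under eq_fun do rewrite big_cons; exact: ccontD.
Qed.

Lemma cont_nsq n (F : 'rV[R]_n -> R[i]) :
  ccont F -> continuous (fun x => nsq (F x) : R^o).
Proof. by move=> [F1 F2]; rewrite /nsq; apply: contD; apply: contM. Qed.

Definition mx_of_real k m (x : 'rV[R]_(k * m + k * m)) : 'M[R[i]]_(k, m) :=
  vec_mx (\row_i (lsubmx x 0 i +i* rsubmx x 0 i)%C).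

Lemma mx_of_realE k m (x : 'rV[R]_(k * m + k * m)) s t :
  mx_of_real x s t = (x 0 (lshift _ (mxvec_index s t))
                      +i* x 0 (rshift _ (mxvec_index s t)))%C.
Proof. by rewrite !mxE. Qed.

Lemma mx_of_real_surj k m (B : 'M[R[i]]_(k, m)) : exists x, mx_of_real x = B.
Proof.
exists (row_mx (\row_i Re (mxvec B 0 i)) (\row_i Im (mxvec B 0 i))).
apply/matrixP => s t; rewrite mx_of_realE row_mxEl row_mxEr !mxE mxvecE.
by case: (B s t).
Qed.

Lemma ccont_coef k m s t :
  ccont (fun x : 'rV[R]_(k * m + k * m) => mx_of_real x s t).
Proof.
by split; under eq_fun do rewrite mx_of_realE /=; exact: coord_continuous.
Qed.

(** In real coordinates the set [h <= 0] is closed and, by the entrywise bound [K], bounded; the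
    extreme value theorem applies on it. *)
Lemma compact_min k m (f h : 'M[R[i]]_(k, m) -> R) (K : R) : 0 <= K ->
  continuous (fun x => f (mx_of_real x) : R^o) ->
  continuous (fun x => h (mx_of_real x) : R^o) ->
  (exists B, h B <= 0) ->
  (forall B, h B <= 0 -> forall i j, normc (B i j) <= K) ->
  exists2 B0, h B0 <= 0 & forall B, h B <= 0 -> f B0 <= f B.
Proof.
move=> K0 cf ch [B1 hB1] hK.
pose A := [set x | h (mx_of_real x) <= 0]%classic.
have A0 : (A !=set0)%classic.
  by have [x xB1] := mx_of_real_surj B1; exists x; rewrite /A /= xB1.
have clA : closed A.
  by apply: (@preimage_closed _ _ (fun x => h (mx_of_real x) : R^o)
    [set y | y <= 0]%classic).
have bA : bounded_set A.
  exists K; split; first exact: num_real.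
  move=> y Ky x Ax; apply: le_trans (ltW Ky).
  rewrite [leLHS]/Num.norm /= mx_normrE; apply/bigmax_leP; split=> //= -[i j] _ /=.
  rewrite ord1 -[j]splitK; case: (fintype.split j) => l /=.
    case/mxvec_indexP: l => s t; have := hK _ Ax s t; rewrite mx_of_realE.
    apply: le_trans; rewrite /= -sqrtr_sqr ler_wsqrtr //.
    by rewrite lerDl sqr_ge0.
  case/mxvec_indexP: l => s t; have := hK _ Ax s t; rewrite mx_of_realE.
  apply: le_trans; rewrite /= -sqrtr_sqr ler_wsqrtr //.
  by rewrite lerDr sqr_ge0.
have [x Ax minx] :=
  EVT_min_rV A0 (bounded_closed_compact bA clA) (continuous_subspaceT cf).
exists (mx_of_real x); first by rewrite inE in Ax.
move=> B hB; have [y yB] := mx_of_real_surj B; rewrite -yB; apply: minx.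
by rewrite inE /A /= yB.
Qed.

End CompactMinimum.

(** * An alternative for sums of values of quadratic maps *)

Section SemidefiniteAlternative.
Variables (R : realType) (M : nat).
Local Notation C := R[i].

Definition qform (Q : 'M[C]_M) (w : 'rV[C]_M) : C := (w *m Q *m w^t*) 0 0.

Definition qfam (J : finType) (Q : 'M[C]_M) (b : J -> 'rV[C]_M) : C :=
  \sum_k qform Q (b k).

Definition rows (B : 'M[C]_M) (k : 'I_M) : 'rV[C]_M := row k B.

Lemma qformZ Q w (c : R) : qform Q (c%:C%C *: w) = (c ^+ 2)%:C%C * qform Q w.
Proof.
rewrite /qform adjZ conjC_realC -!scalemxAl -scalemxAr scalerA mxE.
by rewrite -rmorphM.
Qed.

(** A family enters [qfam] only through its Gram matrix, the sum of the [(b i)^* b i], paired with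
    [Q] by the trace. The rows of a square root of that [M] by [M] matrix therefore replace a family
    of any size. *)
Lemma qfam_reduce (J : finType) (b : J -> 'rV[C]_M) :
  exists B : 'M[C]_M, forall Q, qfam Q b = qfam Q (rows B).
Proof.
have [B hB] := psd_sqrt (psd_sum (fun i => psd_gram (b i))).
exists B => Q.
have qE (I : finType) (d : I -> 'rV[C]_M) :
    qfam Q d = \tr (Q *m \sum_i (d i)^t* *m d i).
  rewrite mulmx_sumr raddf_sum; apply: eq_bigr => i _ /=.
  by rewrite mulmxA mxtrace_mulC mulmxA /mxtrace big_ord1.
rewrite !qE hB; congr (\tr (_ *m _)); apply/matrixP => i j.
rewrite summxE mxE; apply: eq_bigr => k _.
by rewrite !mxE big_ord1 !mxE.
Qed.

Lemma qfam_sum (J1 J2 : finType) Q (b1 : J1 -> 'rV[C]_M) (b2 : J2 -> 'rV[C]_M) :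
  qfam Q (fun k : J1 + J2 => match k with inl i => b1 i | inr i => b2 i end)
  = qfam Q b1 + qfam Q b2.
Proof. by rewrite /qfam big_sumType. Qed.

Variables (I : finType) (Q : I -> 'M[C]_M) (c : I -> C).
Hypothesis coercive :
  forall w : 'rV[C]_M, \sum_i c i * qform (Q i) w = (w *m w^t*) 0 0.
Variable a : I -> C.

Let dist (B : 'M[C]_M) : R := \sum_i nsq (a i - qfam (Q i) (rows B)).

Let dist_ge0 B : 0 <= dist B.
Proof. by apply: sumr_ge0 => i _; exact: nsq_ge0. Qed.

Let dist_eq0 B : dist B = 0 -> forall i, qfam (Q i) (rows B) = a i.
Proof.
move=> /eqP; rewrite psumr_eq0 => [/allP h i|i _]; last exact: nsq_ge0.
have /eqP /nsq_eq0 /eqP := h i (mem_index_enum _).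
by rewrite subr_eq0 => /eqP ->.
Qed.

(** Coercivity writes the total squared norm of the rows of [B] as a combination of the values of
    the forms, and [dist B <= t] keeps each value within [1 + |t|] of its target. *)
Let coef_bound t : exists2 K : R, 0 <= K &
  forall B, dist B - t <= 0 -> forall i j, normc (B i j) <= K.
Proof.
pose S := \sum_i normc (c i) * (normc (a i) + (1 + `|t|)).
have S0 : 0 <= S.
  by apply: sumr_ge0 => i _; rewrite mulr_ge0 ?normc_ge0 ?addr_ge0 ?normc_ge0.
exists (Num.sqrt S); first exact: sqrtr_ge0.
move=> B; rewrite subr_le0 => dB i j.
rewrite -[normc _]ger0_norm ?normc_ge0 // -sqrtr_sqr ler_wsqrtr // -nsqE.
have -> : nsq (B i j) = Re (B i j * (B i j)^* ) by rewrite Re_mulC.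
apply: (@le_trans _ _ (Re (\sum_k (row k B *m (row k B)^t*) 0 0))).
  rewrite Re_sum (bigD1 i) //= mxE Re_sum (bigD1 j) //= !mxE -addrA lerDl.
  rewrite addr_ge0 //; apply: sumr_ge0 => k _.
    by rewrite !mxE Re_mulC nsq_ge0.
  rewrite mxE Re_sum; apply: sumr_ge0 => l _.
  by rewrite !mxE Re_mulC nsq_ge0.
under eq_bigr do rewrite -coercive.
rewrite exchange_big Re_sum /=; apply: ler_sum => l _.
rewrite -mulr_sumr -/(qfam (Q l) (rows B)).
apply: le_trans (Re_le_normc _) _; rewrite Normc.normcM.
rewrite ler_wpM2l ?normc_ge0 //.
set q := qfam _ _.
have -> : q = a l + - (a l - q) by rewrite opprB addrCA subrr addr0.
apply: le_trans (le_normcD _ _) _; rewrite normcN lerD2l.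
have nq : normc (a l - q) ^+ 2 <= t.
  apply: le_trans dB; rewrite -nsqE /dist (bigD1 l) //= lerDl.
  by apply: sumr_ge0 => k _; exact: nsq_ge0.
have : t <= `|t| by exact: ler_norm.
have := sqr_ge0 (normc (a l - q) - 1).
by have := normc_ge0 (a l - q); nra.
Qed.

Let cont_qfam P : ccont (fun x => qfam P (rows (mx_of_real x))).
Proof.
rewrite /qfam /qform; apply: ccont_sum => k.
under eq_fun do rewrite mxE; apply: ccont_sum => j.
have cr l : ccont (fun x => rows (mx_of_real x : 'M[C]_M) k 0 l).
  by under eq_fun do rewrite /rows [row _ _ _ _]mxE; exact: ccont_coef.
under eq_fun do rewrite adjE; apply: ccontM; last exact: ccont_conj.
apply: (@eq_ind _ (fun x => \sum_l rows (mx_of_real x : 'M[C]_M) k 0 l * P l j)).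
  by apply: ccont_sum => l; apply: ccontM => //; exact: ccont_cst.
by apply: funext => x; rewrite mxE.
Qed.

Let cont_dist : continuous (fun x => dist (mx_of_real x) : R^o).
Proof.
apply: cont_sum => i; apply: cont_nsq; apply: ccontD; first exact: ccont_cst.
have := ccontM (@ccont_cst R _ (-1)) (cont_qfam (Q i)).
by under eq_fun do rewrite mulN1r.
Qed.

(** After reduction to [M] vectors the feasible families are the compact set [dist B <= 0]. The
    maximum found there dominates feasible families of every size, since each of them reduces to [M]
    vectors too. *)
Lemma qfam_max (H : 'M[C]_M) (J : finType) (b : J -> 'rV[C]_M) :
  (forall i, qfam (Q i) b = a i) ->
  exists2 B0 : 'M[C]_M, forall i, qfam (Q i) (rows B0) = a i &
    forall (J' : finType) (b' : J' -> 'rV[C]_M),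
      (forall i, qfam (Q i) b' = a i) ->
      Re (qfam H b') <= Re (qfam H (rows B0)).
Proof.
move=> ab.
have [K K0 hK] := coef_bound 0.
have dist0 (B : 'M[C]_M) : (forall i, qfam (Q i) (rows B) = a i) -> dist B - 0 <= 0.
  move=> aB; rewrite /dist big1 ?subr0 // => i _.
  by rewrite aB subrr /nsq /= expr0n addr0.
have [B hB] := qfam_reduce b.
have hB1 : exists B, dist B - 0 <= 0.
  by exists B; apply: dist0 => i; rewrite -hB.
have cd : continuous (fun x => dist (mx_of_real x) - 0 : R^o).
  by under eq_fun do rewrite subr0.
have [B0 dB0 minB0] :=
  @compact_min R M M (fun B => - Re (qfam H (rows B))) _ K K0
    (contN (proj1 (cont_qfam H))) cd hB1 hK.
exists B0.
  apply: dist_eq0; apply/eqP; rewrite eq_le dist_ge0 andbT.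
  by move: dB0; rewrite subr0.
move=> J' b' ab'; have [B' hB'] := qfam_reduce b'.
rewrite hB' -lerN2; apply: minB0; apply: dist0 => i; by rewrite -hB'.
Qed.

(** The attainable value vectors form a convex cone. Coercivity provides a point of it nearest to
    [a]; if its residual [r] is nonzero, then the conjugate of [r] separates [a] from the cone. *)
Lemma qfam_alternative :
  (exists B : 'M[C]_M, forall i, qfam (Q i) (rows B) = a i) \/
  (exists y : I -> C, (forall w, Re (\sum_i y i * qform (Q i) w) <= 0) /\
     0 < Re (\sum_i y i * a i)).
Proof.
(* The sublevel set at [dist 0] is nonempty, as it contains the zero matrix, and outside it [dist]
   exceeds [dist 0]; a minimum on it is thus global. *)
have [K K0 hK] := coef_bound (dist 0).
have cd : continuous (fun x => dist (mx_of_real x) - dist 0 : R^o).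
  by apply: contD => //; exact: cst_continuous.
have [|B0 _ minB] := compact_min K0 cont_dist cd _ hK.
  by exists 0; rewrite subrr.
have {}minB B : dist B0 <= dist B.
  have [dB|/ltW dB] := leP (dist B) (dist 0); first by apply: minB; rewrite subr_le0.
  by apply: le_trans dB; apply: minB; rewrite subrr.
pose r i := a i - qfam (Q i) (rows B0).
(* When the values move by [s * z], minimality of [dist B0] bounds the linear term of the change by
   the quadratic one. *)
have step s (z : I -> C) (J : finType) (b : J -> 'rV[C]_M) :
    (forall i, qfam (Q i) b = qfam (Q i) (rows B0) + s%:C%C * z i) ->
    s * Re (\sum_i (r i)^* * (2 * z i)) <= s ^+ 2 * \sum_i nsq (z i).
  move=> bE; have [B hB] := qfam_reduce b.
  have := minB B; rewrite /dist.
  have -> : \sum_i nsq (a i - qfam (Q i) (rows B))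
      = dist B0 - s * (\sum_i 2 * Re ((r i)^* * z i)) + s ^+ 2 * \sum_i nsq (z i).
    rewrite !mulr_sumr -sumrN -!big_split; apply: eq_bigr => i _ /=.
    by rewrite -hB bE opprD addrA -/(r i) nsq_sub_scale.
  have -> : Re (\sum_i (r i)^* * (2 * z i)) = \sum_i 2 * Re ((r i)^* * z i).
    rewrite Re_sum; apply: eq_bigr => i _; rewrite mulrCA -Re_real.
    by rewrite rmorph_nat.
  rewrite -/(dist B0); lra.
have half (z : I -> C) : Re (\sum_i (r i)^* * (2 * z i)) = 2 * Re (\sum_i (r i)^* * z i).
  rewrite -Re_real mulr_sumr; congr Re; apply: eq_bigr => i _.
  by rewrite mulrCA rmorph_nat.
have neg w : Re (\sum_i (r i)^* * qform (Q i) w) <= 0.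
  suff : Re (\sum_i (r i)^* * (2 * qform (Q i) w)) <= 0 by rewrite half; lra.
  apply: (@le0_small _ _ (\sum_i nsq (qform (Q i) w))) => s s0 s1.
  (* Adjoining the vector [sqrt s *: w] moves the values by exactly [s] times those of [w]. *)
  pose b (k : 'I_M + 'I_1) := match k with
    inl i => row i B0 | inr _ => (Num.sqrt s)%:C%C *: w end.
  apply: (step _ _ _ b) => i.
  rewrite (qfam_sum (Q i) (rows B0) (fun _ : 'I_1 => (Num.sqrt s)%:C%C *: w)).
  by rewrite {2}/qfam big_ord1 qformZ sqr_sqrtr // ltW.
(* Shrinking all rows by [sqrt (1 - s)] moves the values in the direction opposite to those of
   [B0]. *)
have pos : 0 <= Re (\sum_i (r i)^* * qfam (Q i) (rows B0)).
  suff : Re (\sum_i (r i)^* * (2 * - qfam (Q i) (rows B0))) <= 0.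
    rewrite half; under eq_bigr do rewrite mulrN.
    by rewrite sumrN ReN; lra.
  apply: (@le0_small _ _ (\sum_i nsq (- qfam (Q i) (rows B0)))) => s s0 s1.
  apply: (step _ _ _ (fun k => (Num.sqrt (1 - s))%:C%C *: row k B0)) => i.
  rewrite /qfam; under eq_bigr do rewrite qformZ sqr_sqrtr ?subr_ge0 ?(ltW s1) //.
  by rewrite -mulr_sumr rmorphB rmorph1 mulrBl mul1r mulrN.
have [d0|d0] := eqVneq (dist B0) 0; [left|right].
  by exists B0; exact: dist_eq0.
(* The pairing of [r] with [a] exceeds its pairing with the values at [B0] by the squared length of
   [r], which is [dist B0 > 0]. *)
exists (fun i => (r i)^* ); split=> //.
have -> : Re (\sum_i (r i)^* * a i)
    = Re (\sum_i (r i)^* * qfam (Q i) (rows B0)) + dist B0.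
  rewrite /dist !Re_sum -big_split; apply: eq_bigr => i _ /=.
  rewrite -/(r i) -Re_mulC -ReD -[r i * _]mulrC -mulrDr; congr (Re (_ * _)).
  by rewrite /r addrC subrK.
by rewrite ltr_wpDl // lt_neqAle eq_sym d0 dist_ge0.
Qed.

End SemidefiniteAlternative.

(** * Contractive representations of pencils *)

Section QuadraticForms.
Variables (R : realType) (M : nat).
Local Notation C := R[i].

(** A sigma type, so that the matrix can be extracted and handed to [qfam_max] and
    [qfam_alternative]. *)
Definition quadratic (f : 'rV[C]_M -> C) : Type :=
  {Q : 'M[C]_M | forall w, qform Q w = f w}.

Lemma quadratic_mono i j : quadratic (fun w => (w 0 j)^* * w 0 i).
Proof.
exists (delta_mx i j) => w; rewrite /qform mxE (bigD1 j) //= big1 => [|l lj].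
  rewrite adjE mxE (bigD1 i) //= big1 => [|l li]; rewrite !mxE ?eqxx.
    by rewrite !addr0 mulr1 mulrC.
  by rewrite (negPf li) mulr0.
rewrite mxE big1 ?mul0r // => s _.
by rewrite mxE (negPf lj) andbF mulr0.
Qed.

Lemma quadratic0 : quadratic (fun _ => 0).
Proof. by exists 0 => w; rewrite /qform mulmx0 mul0mx mxE. Qed.

Lemma quadraticD f h : quadratic f -> quadratic h -> quadratic (fun w => f w + h w).
Proof.
move=> [P hP] [Q hQ]; exists (P + Q) => w.
by rewrite -hP -hQ /qform mulmxDr mulmxDl mxE.
Qed.

Lemma quadraticZ c f : quadratic f -> quadratic (fun w => c * f w).
Proof.
move=> [P hP]; exists (c *: P) => w.
by rewrite -hP /qform -scalemxAr -scalemxAl mxE.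
Qed.

Lemma quadratic_ext f h : f =1 h -> quadratic f -> quadratic h.
Proof. by move=> fh [P hP]; exists P => w; rewrite hP. Qed.

Lemma quadratic_sum (J : finType) (f : J -> 'rV[C]_M -> C) :
  (forall i, quadratic (f i)) -> quadratic (fun w => \sum_i f i w).
Proof.
move=> qf; elim: (index_enum J) => [|j s IHs].
  by apply: quadratic_ext quadratic0 => w; rewrite big_nil.
by apply: quadratic_ext (quadraticD (qf j) IHs) => w; rewrite big_cons.
Qed.

Lemma quadratic_adjmul m n m' n' (X : 'rV[C]_M -> 'M[C]_(m, n))
    (Y : 'rV[C]_M -> 'M[C]_(m', n')) (x : 'I_m -> 'I_n -> 'I_M)
    (y : 'I_m' -> 'I_n' -> 'I_M) (K : 'M[C]_(m, m')) s t :
  (forall w i j, X w i j = w 0 (x i j)) -> (forall w i j, Y w i j = w 0 (y i j)) ->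
  quadratic (fun w => ((X w)^t* *m K *m Y w) s t).
Proof.
move=> Xx Yy; apply: (@quadratic_ext
    (fun w => \sum_j \sum_i K i j * ((w 0 (x i s))^* * w 0 (y j t)))).
  move=> w; rewrite mxE; apply: eq_bigr => j _; rewrite mxE mulr_suml.
  apply: eq_bigr => i _; rewrite adjE Xx Yy; ring.
apply: quadratic_sum => j; apply: quadratic_sum => i.
exact/quadraticZ/quadratic_mono.
Qed.

End QuadraticForms.

Lemma sum_pair (V : nmodType) (I J : finType) (f : I * J -> V) :
  \sum_p f p = \sum_i \sum_j f (i, j).
Proof. by rewrite pair_bigA; apply: eq_bigr => -[]. Qed.

Lemma mxaddE (V : nmodType) m n (A B : 'M[V]_(m, n)) i j :
  (A + B) i j = A i j + B i j.
Proof. by rewrite mxE. Qed.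

(** * Representations of pencils as solutions of quadratic equations *)

Section ContractiveRepresentations.
Variables (R : realType) (g : nat).
Local Notation C := R[i].

(** Stacking the families into block columns [W] and [W'], this is the factorization
    [A_j = W'^* (1 ⊗ K_j) W] with [W] and [W'] contractions. *)
Definition crep a' a k' k (A : pencil R g a' a) (K : pencil R g k' k)
    (J : finType) (W : J -> 'M[C]_(k, a)) (W' : J -> 'M[C]_(k', a')) : Prop :=
  [/\ forall j, A j = \sum_i (W' i)^t* *m K j *m W i,
      psd (1%:M - \sum_i (W i)^t* *m W i) &
      psd (1%:M - \sum_i (W' i)^t* *m W' i)].

Section Encoding.
Variables (a' a k' k : nat) (A : pencil R g a' a) (K : pencil R g k' k).

(* The last two blocks of a parameter vector are slack rows, which turn the two
   inequality constraints of [crep] into equations. *)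
Let M := ((k * a + k' * a') + (a + a'))%N.
Implicit Type w : 'rV[C]_M.

Let Wof w : 'M[C]_(k, a) := vec_mx (lsubmx (lsubmx w)).
Let W'of w : 'M[C]_(k', a') := vec_mx (rsubmx (lsubmx w)).
Let rof w : 'rV[C]_a := lsubmx (rsubmx w).
Let r'of w : 'rV[C]_a' := rsubmx (rsubmx w).
Let enc (W : 'M[C]_(k, a)) (W' : 'M[C]_(k', a')) r r' : 'rV[C]_M :=
  row_mx (row_mx (mxvec W) (mxvec W')) (row_mx r r').

Let WofE W W' r r' : Wof (enc W W' r r') = W.
Proof. by rewrite /Wof /enc row_mxKl row_mxKl mxvecK. Qed.
Let W'ofE W W' r r' : W'of (enc W W' r r') = W'.
Proof. by rewrite /W'of /enc row_mxKl row_mxKr mxvecK. Qed.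
Let rofE W W' r r' : rof (enc W W' r r') = r.
Proof. by rewrite /rof /enc row_mxKr row_mxKl. Qed.
Let r'ofE W W' r r' : r'of (enc W W' r r') = r'.
Proof. by rewrite /r'of /enc row_mxKr row_mxKr. Qed.

Let encK w : enc (Wof w) (W'of w) (rof w) (r'of w) = w.
Proof. by rewrite /enc !vec_mxK !hsubmxK. Qed.

Definition constraint_index : finType :=
  (('I_g * 'I_a' * 'I_a) + (('I_a * 'I_a) + ('I_a' * 'I_a')))%type.

Let F (i : constraint_index) w : C := match i with
  | inl (j, s, t) => ((W'of w)^t* *m K j *m Wof w) s t
  | inr (inl (s, t)) => ((Wof w)^t* *m Wof w + (rof w)^t* *m rof w) s t
  | inr (inr (s, t)) => ((W'of w)^t* *m W'of w + (r'of w)^t* *m r'of w) s t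
  end.

Let target (i : constraint_index) : C := match i with
  | inl (j, s, t) => A j s t
  | inr (inl (s, t)) => (1%:M : 'M[C]_a) s t
  | inr (inr (s, t)) => (1%:M : 'M[C]_a') s t
  end.

(** Picks out the traces of the two normalization blocks, which add up to the squared norm of the
    parameter vector; this is the source of coercivity. *)
Let weight (i : constraint_index) : C := match i with
  | inl _ => 0
  | inr (inl (s, t)) => (s == t)%:R
  | inr (inr (s, t)) => (s == t)%:R
  end.

Let Wcoord w s t : Wof w s t = w 0 (lshift _ (lshift _ (mxvec_index s t))).
Proof. by rewrite !mxE. Qed.
Let W'coord w s t : W'of w s t = w 0 (lshift _ (rshift _ (mxvec_index s t))).
Proof. by rewrite !mxE. Qed.
Let rcoord w (s : 'I_1) t : rof w s t = w 0 (rshift _ (lshift _ t)).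
Proof. by rewrite !mxE ord1. Qed.
Let r'coord w (s : 'I_1) t : r'of w s t = w 0 (rshift _ (rshift _ t)).
Proof. by rewrite !mxE ord1. Qed.

Let quadF i : quadratic (F i).
Proof.
have gramE m n (X : 'M[C]_(m, n)) : X^t* *m X = X^t* *m 1%:M *m X.
  by rewrite mulmx1.
case: i => [[[j s] t]|[[s t]|[s t]]].
- exact: (quadratic_adjmul _ _ _ W'coord Wcoord).
- apply: quadratic_ext
    (quadraticD (quadratic_adjmul 1%:M s t Wcoord Wcoord)
                (quadratic_adjmul 1%:M s t rcoord rcoord)) => w.
  by rewrite !mulmx1 /= [RHS]mxE.
- apply: quadratic_ext
    (quadraticD (quadratic_adjmul 1%:M s t W'coord W'coord)
                (quadratic_adjmul 1%:M s t r'coord r'coord)) => w.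
  by rewrite !mulmx1 /= [RHS]mxE.
Qed.

Let Q i : 'M[C]_M := projT1 (quadF i).
Let QE i w : qform (Q i) w = F i w.
Proof. exact: (projT2 (quadF i)). Qed.

Let mxvec_dot m n (B : 'M[C]_(m, n)) : (mxvec B *m (mxvec B)^t*) 0 0 = hs B.
Proof.
rewrite mxE hsE pair_bigA.
rewrite (reindex _ (curry_mxvec_bij _ _)) /=.
by apply: eq_bigr => -[i j] _ /=; rewrite adjE mxvecE normCK.
Qed.

Let row_dot m (r : 'rV[C]_m) : (r *m r^t*) 0 0 = hs r.
Proof. by rewrite /hs mxtrace_mulC /mxtrace big_ord1. Qed.

Let sum_diag n (B : 'I_n * 'I_n -> C) :
  \sum_(p : 'I_n * 'I_n) (p.1 == p.2)%:R * B p = \sum_s B (s, s).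
Proof.
rewrite sum_pair /=.
apply: eq_bigr => s _; rewrite (bigD1 s) //= eqxx mul1r big1 ?addr0 // => t ts.
by rewrite eq_sym (negPf ts) mul0r.
Qed.

Let coercive w : \sum_i weight i * qform (Q i) w = (w *m w^t*) 0 0.
Proof.
under eq_bigr do rewrite QE.
rewrite -[in RHS](encK w) /enc !(tr_row_mx, map_col_mx, mul_row_col).
rewrite !mxaddE !mxvec_dot !row_dot big_sumType /= big1 ?add0r; last first.
  by move=> i _; rewrite mul0r.
rewrite big_sumType.
have -> : \sum_p weight (inr (inl p)) * F (inr (inl p)) w
    = \sum_s F (inr (inl (s, s))) w.
  by rewrite -(sum_diag (fun p => F (inr (inl p)) w)); apply: eq_bigr => -[].
have -> : \sum_p weight (inr (inr p)) * F (inr (inr p)) w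
    = \sum_s F (inr (inr (s, s))) w.
  by rewrite -(sum_diag (fun p => F (inr (inr p)) w)); apply: eq_bigr => -[].
rewrite /F -/(\tr (_ + _)) -/(\tr (_ + _)) !mxtraceD /hs /=; ring.
Qed.

Let qfamE (J : finType) (b : J -> 'rV[C]_M) i : qfam (Q i) b = \sum_k F i (b k).
Proof. by apply: eq_bigr => l _; rewrite QE. Qed.

Let crep_of_qfam (J : finType) (b : J -> 'rV[C]_M) :
  (forall i, qfam (Q i) b = target i) ->
  crep A K (fun i => Wof (b i)) (fun i => W'of (b i)).
Proof.
move=> hb; split.
- move=> j; apply/matrixP => s t; have := hb (inl (j, s, t)).
  by rewrite qfamE /= => <-; rewrite summxE.
- have -> : 1%:M = \sum_i ((Wof (b i))^t* *m Wof (b i) + (rof (b i))^t* *m rof (b i)).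
    apply/matrixP => s t; have := hb (inr (inl (s, t))).
    by rewrite qfamE /= => <-; rewrite summxE.
  rewrite big_split /= addrAC subrr add0r; apply: psd_sum => i; exact: psd_gram.
- have -> : 1%:M = \sum_i ((W'of (b i))^t* *m W'of (b i) + (r'of (b i))^t* *m r'of (b i)).
    apply/matrixP => s t; have := hb (inr (inr (s, t))).
    by rewrite qfamE /= => <-; rewrite summxE.
  rewrite big_split /= addrAC subrr add0r; apply: psd_sum => i; exact: psd_gram.
Qed.

(** The rows of factors of the two defects become the slack vectors, each put in a parameter vector
    of its own that is zero elsewhere. *)
Let qfam_of_crep (J : finType) W W' : @crep a' a k' k A K J W W' ->
  exists (m m' : nat) (r : 'I_m -> 'rV[C]_a) (r' : 'I_m' -> 'rV[C]_a'),
  forall i, qfam (Q i) (fun x : J + ('I_m + 'I_m') => match x with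
    | inl i => enc (W i) (W' i) 0 0
    | inr (inl i) => enc 0 0 (r i) 0
    | inr (inr i) => enc 0 0 0 (r' i) end) = target i.
Proof.
have rowE m n (B : 'M[C]_(m, n)) : B^t* *m B = \sum_i (row i B)^t* *m row i B.
  apply/matrixP => s t; rewrite summxE mxE; apply: eq_bigr => i _.
  by rewrite !mxE big_ord1 !mxE.
move=> [hA [m [S hS]] [m' [S' hS']]].
exists m, m', (fun i => row i S), (fun i => row i S') => i; rewrite qfamE !big_sumType /=.
case: i => [[[j s] t]|[[s t]|[s t]]] /=.
- under eq_bigr do rewrite WofE W'ofE.
  under [X in _ + (X + _)]eq_bigr do rewrite WofE W'ofE mulmx0 mxE.
  under [X in _ + (_ + X)]eq_bigr do rewrite WofE W'ofE mulmx0 mxE.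
  by rewrite hA !big1_eq !addr0 summxE.
- under eq_bigr do rewrite WofE rofE mulmx0 addr0.
  under [X in _ + (X + _)]eq_bigr do rewrite WofE rofE mulmx0 add0r.
  under [X in _ + (_ + X)]eq_bigr do rewrite WofE rofE !mulmx0 addr0 mxE.
  rewrite big1_eq addr0 -!summxE -rowE -hS.
  by rewrite -mxaddE addrC subrK.
- under eq_bigr do rewrite W'ofE r'ofE mulmx0 addr0.
  under [X in _ + (X + _)]eq_bigr do rewrite W'ofE r'ofE !mulmx0 addr0 mxE.
  under [X in _ + (_ + X)]eq_bigr do rewrite W'ofE r'ofE mulmx0 add0r.
  rewrite big1_eq add0r -!summxE -rowE -hS'.
  by rewrite -mxaddE addrC subrK.
Qed.

(** Up to slack, representations are the families with prescribed quadratic values, and the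
    objective is quadratic in the [W] block alone; the slack vectors add nothing to it, so
    [qfam_max] applies. *)
Lemma crep_max (J : finType) W W' : @crep a' a k' k A K J W W' ->
  exists (J0 : finType) W0 W0', @crep a' a k' k A K J0 W0 W0' /\
    forall (J1 : finType) W1 W1', @crep a' a k' k A K J1 W1 W1' ->
    Re (\sum_i \sum_j hs (K j *m W1 i)) <= Re (\sum_i \sum_j hs (K j *m W0 i)).
Proof.
move=> /qfam_of_crep [m [m' [r [r' hb]]]].
have obj : quadratic (fun w => \sum_j hs (K j *m Wof w)).
  apply: quadratic_sum => j.
  apply: (@quadratic_ext _ _ (fun w =>
    \sum_s ((Wof w)^t* *m ((K j)^t* *m K j) *m Wof w) s s)).
    by move=> w; rewrite /hs adjM !mulmxA.
  apply: quadratic_sum => s; exact: (quadratic_adjmul _ _ _ Wcoord Wcoord).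
have [B0 hB0 maxB0] := qfam_max coercive (projT1 obj) hb.
have objE (J' : finType) (b : J' -> 'rV[C]_M) :
    qfam (projT1 obj) b = \sum_i \sum_j hs (K j *m Wof (b i)).
  by apply: eq_bigr => i _; exact: (projT2 obj).
exists 'I_M, (fun i => Wof (rows B0 i)), (fun i => W'of (rows B0 i)).
split; first exact: crep_of_qfam hB0.
move=> J1 W1 W1' /qfam_of_crep [m1 [m1' [r1 [r1' hb1]]]].
have := maxB0 _ _ hb1; rewrite !objE; apply: le_trans.
rewrite !big_sumType /=.
under [X in _ <= Re (X + _)]eq_bigr do under eq_bigr do rewrite WofE.
rewrite [X in _ + (X + _)]big1 => [|i _].
  rewrite [X in _ + (_ + X)]big1 => [|i _]; first by rewrite !addr0.
  by rewrite big1 // => j _; rewrite WofE mulmx0 hs0.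
by rewrite big1 // => j _; rewrite WofE mulmx0 hs0.
Qed.

(** The separating multipliers are arranged into matrices with transposed indices, so that the
    separating functional becomes a sum of traces. *)
Lemma crep_or_separated :
  (exists (J : finType) W W', @crep a' a k' k A K J W W') \/
  (exists (X : 'I_g -> 'M[C]_(a, a')) (rho : 'M[C]_a) (rho' : 'M[C]_a'),
    (forall (W : 'M[C]_(k, a)) (W' : 'M[C]_(k', a')) (r : 'rV[C]_a) (r' : 'rV[C]_a'),
      Re (\sum_j \tr (X j *m (W'^t* *m K j *m W))
          + (\tr (rho *m (W^t* *m W + r^t* *m r))
             + \tr (rho' *m (W'^t* *m W' + r'^t* *m r')))) <= 0) /\
    0 < Re (\sum_j \tr (X j *m A j) + (\tr rho + \tr rho'))).
Proof.
have [[B /crep_of_qfam hB]|[y [yle yA]]] := qfam_alternative coercive target.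
  by left; exists 'I_M, (fun i => Wof (rows B i)), (fun i => W'of (rows B i)).
right; exists (fun j => \matrix_(t, s) y (inl (j, s, t))).
exists (\matrix_(t, s) y (inr (inl (s, t)))).
exists (\matrix_(t, s) y (inr (inr (s, t)))).
have trE m n (Y : 'I_m * 'I_n -> C) (B : 'M[C]_(m, n)) (Z : 'I_m * 'I_n -> C) :
    (forall s t, Z (s, t) = B s t) ->
    \tr ((\matrix_(t, s) Y (s, t)) *m B) = \sum_p Y p * Z p.
  move=> ZB; rewrite sum_pair exchange_big.
  apply: eq_bigr => t _; rewrite mxE; apply: eq_bigr => s _.
  by rewrite mxE ZB.
have sumE (f : constraint_index -> C) (T : 'I_g -> 'M[C]_(a', a))
      (G : 'M[C]_a) (G' : 'M[C]_a') :
    (forall j s t, f (inl (j, s, t)) = T j s t) ->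
    (forall s t, f (inr (inl (s, t))) = G s t) ->
    (forall s t, f (inr (inr (s, t))) = G' s t) ->
    \sum_i y i * f i =
    \sum_j \tr ((\matrix_(t, s) y (inl (j, s, t))) *m T j)
    + (\tr ((\matrix_(t, s) y (inr (inl (s, t)))) *m G)
       + \tr ((\matrix_(t, s) y (inr (inr (s, t)))) *m G')).
  move=> fT fG fG'; rewrite !big_sumType /=; congr (_ + (_ + _)).
  - rewrite sum_pair sum_pair; apply: eq_bigr => j _.
    rewrite (trE _ _ (fun p => y (inl (j, p.1, p.2))) _
      (fun p => f (inl (j, p.1, p.2)))) //.
    by rewrite sum_pair.
  - by rewrite (trE _ _ (fun p => y (inr (inl p))) _ (fun p => f (inr (inl p)))).
  - by rewrite (trE _ _ (fun p => y (inr (inr p))) _ (fun p => f (inr (inr p)))).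
split.
  move=> W W' r r'; have := yle (enc W W' r r').
  under eq_bigr do rewrite QE.
  rewrite (sumE (F^~ _) (fun j => W'^t* *m K j *m W) (W^t* *m W + r^t* *m r)
     (W'^t* *m W' + r'^t* *m r')) // => *.
  - by rewrite /= WofE W'ofE.
  - by rewrite /= WofE rofE.
  - by rewrite /= W'ofE r'ofE.
by move: yA; rewrite (sumE target A 1%:M 1%:M) // !mulmx1.
Qed.

End Encoding.
End ContractiveRepresentations.

(** * Operator norms and the factorization theorem *)

Lemma Re_ge0 (R : realType) (z : R[i]) : 0 <= z -> 0 <= Re z.
Proof. exact: ler_Re. Qed.

Section FrobeniusNorm.
Variable R : realType.
Local Notation C := R[i].

Definition fnorm m n (A : 'M[C]_(m, n)) : R := Num.sqrt (Re (hs A)).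

Lemma fnorm_ge0 m n (A : 'M[C]_(m, n)) : 0 <= fnorm A.
Proof. exact: sqrtr_ge0. Qed.

Lemma fnorm_sqr m n (A : 'M[C]_(m, n)) : fnorm A ^+ 2 = Re (hs A).
Proof. by rewrite sqr_sqrtr // Re_ge0 // hs_ge0. Qed.

Lemma fnorm_eq0 m n (A : 'M[C]_(m, n)) : fnorm A = 0 -> A = 0.
Proof.
move=> A0; apply: hs_eq0; rewrite (ge0_realC (hs_ge0 A)) -fnorm_sqr A0.
by rewrite expr0n.
Qed.

Lemma fnorm0 m n : fnorm (0 : 'M[C]_(m, n)) = 0.
Proof. by rewrite /fnorm hs0 sqrtr0. Qed.

Lemma fnormZ m n (r : R) (A : 'M[C]_(m, n)) : fnorm (r%:C%C *: A) = `|r| * fnorm A.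
Proof.
rewrite /fnorm /hs adjZ conjC_realC -scalemxAl -scalemxAr scalerA linearZ /=.
by rewrite -rmorphM Re_real -expr2 sqrtrM ?sqr_ge0 // sqrtr_sqr.
Qed.

Lemma Re_trace_mulC m n (A B : 'M[C]_(m, n)) :
  Re (\tr (A^t* *m B)) = Re (\tr (B^t* *m A)).
Proof. by rewrite -cRe_conj -mxtrace_adj adjM trmxCK. Qed.

Lemma Re_hs_comb m n (A B : 'M[C]_(m, n)) (b a : R) :
  Re (hs (b%:C%C *: A - a%:C%C *: B))
  = b ^+ 2 * Re (hs A) - 2 * a * b * Re (\tr (A^t* *m B)) + a ^+ 2 * Re (hs B).
Proof.
have e (c d : R) (X Y : 'M[C]_(m, n)) :
    \tr ((c%:C%C *: X)^t* *m (d%:C%C *: Y)) = (c * d)%:C%C * \tr (X^t* *m Y).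
  rewrite adjZ (conjC_realC c) -scalemxAl -scalemxAr scalerA.
  by rewrite [LHS]linearZ /= rmorphM.
rewrite hs_sub /hs (e b b A A) (e a b B A) (e b a A B) (e a a B B).
by rewrite !ReD !ReN !Re_real (Re_trace_mulC B A); ring.
Qed.

Lemma fnorm_CauchySchwarz m n (A B : 'M[C]_(m, n)) :
  Re (\tr (A^t* *m B)) <= fnorm A * fnorm B.
Proof.
have [az|an] := eqVneq (fnorm A) 0.
  by rewrite az (fnorm_eq0 az) adj0 mul0mx mxtrace0 mul0r.
have [bz|bn] := eqVneq (fnorm B) 0.
  by rewrite bz (fnorm_eq0 bz) mulmx0 mxtrace0 mulr0.
have := Re_ge0 (hs_ge0 ((fnorm B)%:C%C *: A - (fnorm A)%:C%C *: B)).
rewrite Re_hs_comb -(fnorm_sqr A) -(fnorm_sqr B).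
have := fnorm_ge0 B; have := fnorm_ge0 A; move: (fnorm A) (fnorm B) an bn (Re _).
move=> a b a0 b0 x ap bp /= h.
have ab : 0 < a * b by rewrite mulr_gt0 // lt_neqAle eq_sym ?a0 ?b0.
rewrite -(ler_pM2l ab); nra.
Qed.

Lemma l2normE k (v : 'cV[C]_k) : l2norm v = fnorm v.
Proof.
rewrite /l2norm /fnorm hsE Re_sum; congr (Num.sqrt _); apply: eq_bigr => i _.
by rewrite big_ord1 normCK Re_mulC nsqE.
Qed.

Lemma opnorm_ub h k (A : 'M[C]_(h, k)) (v : 'cV[C]_k) :
  fnorm (A *m v) <= opnorm A * fnorm v.
Proof.
have [v0|vn] := eqVneq (fnorm v) 0.
  by rewrite v0 (fnorm_eq0 v0) mulmx0 fnorm0 mulr0.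
have vp : 0 < fnorm v by rewrite lt_neqAle eq_sym vn fnorm_ge0.
have vi : 0 <= (fnorm v)^-1 by rewrite invr_ge0 ltW.
rewrite -ler_pdivrMr // /opnorm; apply: sup_upper_bound.
  exact: opnorm_has_sup.
exists ((fnorm v)^-1%:C%C *: v).
  by rewrite l2normE fnormZ (ger0_norm vi) mulVf.
by rewrite l2normE -scalemxAr fnormZ (ger0_norm vi) mulrC.
Qed.

Lemma opnorm_le h k (A : 'M[C]_(h, k)) (c : R) : 0 <= c ->
  (forall v : 'cV[C]_k, fnorm (A *m v) <= c * fnorm v) -> opnorm A <= c.
Proof.
move=> c0 hA; apply: ge_sup; first by have [] := opnorm_has_sup A.
move=> _ [v v1 ->]; rewrite l2normE; apply: le_trans (hA v) _.
by rewrite ler_piMr // -l2normE.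
Qed.

Lemma opnorm_ge0 h k (A : 'M[C]_(h, k)) : 0 <= opnorm A.
Proof.
apply: sup_upper_bound; first exact: opnorm_has_sup.
by exists 0; rewrite l2normE ?mulmx0 fnorm0 // ler01.
Qed.

Lemma opnorm_eq0 h k (A : 'M[C]_(h, k)) : opnorm A = 0 -> A = 0.
Proof.
move=> A0; apply/matrixP => i j; rewrite mxE.
have /fnorm_eq0 /matrixP /(_ i 0) : fnorm (A *m delta_mx j (0 : 'I_1)) = 0.
  apply/le_anti; rewrite fnorm_ge0 andbT.
  by have := opnorm_ub A (delta_mx j 0); rewrite A0 mul0r.
by rewrite -colE !mxE.
Qed.

Lemma opnorm0 h k : opnorm (0 : 'M[C]_(h, k)) = 0.
Proof.
apply/le_anti; rewrite opnorm_ge0 andbT; apply: opnorm_le => // v.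
by rewrite mul0mx fnorm0 mul0r.
Qed.

Lemma opnormZ h k (r : R) (A : 'M[C]_(h, k)) : 0 < r ->
  opnorm (r%:C%C *: A) = r * opnorm A.
Proof.
move=> r0; apply/le_anti/andP; split.
  apply: opnorm_le => [|v]; first by rewrite mulr_ge0 ?opnorm_ge0 ?(ltW r0).
  by rewrite -scalemxAl fnormZ (ger0_norm (ltW r0)) -mulrA ler_pM2l // opnorm_ub.
rewrite -ler_pdivlMl //; apply: opnorm_le => [|v].
  by rewrite mulr_ge0 ?invr_ge0 ?opnorm_ge0 ?(ltW r0).
have := opnorm_ub (r%:C%C *: A) v.
rewrite -scalemxAl fnormZ (ger0_norm (ltW r0)) -mulrA.
by rewrite ler_pdivlMl.
Qed.

Lemma opnorm_trace_ub h k n (A : 'M[C]_(h, k)) (U : 'M[C]_(h, n)) V :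
  n = 1%N -> Re (\tr (U^t* *m A *m V)) <= opnorm A * (fnorm V * fnorm U).
Proof.
move=> n1; subst n; rewrite -mulmxA; apply: le_trans (fnorm_CauchySchwarz _ _) _.
by rewrite mulrC mulrA ler_wpM2r ?fnorm_ge0 ?opnorm_ub.
Qed.

Lemma opnorm_trace_le h k (A : 'M[C]_(h, k)) (c : R) : 0 <= c ->
  (forall (U : 'cV[C]_h) (V : 'cV[C]_k),
     Re (\tr (U^t* *m A *m V)) <= c * (fnorm V * fnorm U)) -> opnorm A <= c.
Proof.
move=> c0 hA; apply: opnorm_le => // v.
have := hA (A *m v) v; rewrite -mulmxA -/(hs _) -fnorm_sqr mulrA expr2.
have [->|vn] := eqVneq (fnorm (A *m v)) 0.
  by rewrite mulr_ge0 // fnorm_ge0.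
by rewrite ler_pM2r // lt_neqAle eq_sym vn fnorm_ge0.
Qed.

Lemma opnorm_le2 h k (A : 'M[C]_(h, k)) :
  (forall (U : 'cV[C]_h) (V : 'cV[C]_k),
     Re (\tr (U^t* *m A *m V)) <= fnorm V ^+ 2 + fnorm U ^+ 2) -> opnorm A <= 2.
Proof.
move=> hA; apply: opnorm_le => // v.
(* This choice of [U] gives [|A v|^2 / 2 <= |v|^2 + |A v|^2 / 4], that is [|A v| <= 2 |v|]. *)
have := hA ((2^-1)%:C%C *: (A *m v)) v.
rewrite adjZ conjC_realC -!scalemxAl linearZ /= Re_real -mulmxA -/(hs _) -fnorm_sqr.
have i2 : 0 <= 2^-1 :> R by rewrite invr_ge0.
rewrite fnormZ (ger0_norm i2) => le.
rewrite -(@ler_pXn2r _ 2) ?nnegrE ?mulr_ge0 ?fnorm_ge0 //.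
by move: le; move: (fnorm v) (fnorm _) => x y; rewrite !exprMn; nra.
Qed.

End FrobeniusNorm.

(** * Evaluations of pencils acting on matrices *)

Section PencilAction.
Variable R : realType.
Local Notation C := R[i].

(** Row-major vectorization, matched to the index order of [*t]: under it [K ⊗ X] acts by
    [H -> K H X^T], as shown in [tens_tvec]. *)
Definition tvec k n (H : 'M[C]_(k, n)) : 'cV[C]_(k * n) :=
  \col_i H (mxtens_unindex i).1 (mxtens_unindex i).2.

Definition tmat k n (h : 'cV[C]_(k * n)) : 'M[C]_(k, n) :=
  \matrix_(s, t) h (mxtens_index (s, t)) 0.

Lemma tvecE k n (H : 'M[C]_(k, n)) s t j : tvec H (mxtens_index (s, t)) j = H s t.
Proof. by rewrite mxE mxtens_indexK. Qed.

Lemma tmatK k n (h : 'cV[C]_(k * n)) : tvec (tmat h) = h.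
Proof.
apply/colP => i; case: (mxtens_indexP i) => s t.
by rewrite tvecE mxE.
Qed.

Lemma sum_mxtens k n (F : 'I_(k * n) -> C) :
  \sum_i F i = \sum_s \sum_t F (mxtens_index (s, t)).
Proof.
rewrite pair_bigA (reindex (@mxtens_index k n)) /=.
  by apply: eq_bigr => -[].
exists (@mxtens_unindex k n) => x _; [exact: mxtens_indexK|exact: mxtens_unindexK].
Qed.

Lemma tvec_inner k n (H H' : 'M[C]_(k, n)) :
  \tr ((tvec H')^t* *m tvec H) = \tr (H'^t* *m H).
Proof.
rewrite /mxtrace big_ord1 mxE sum_mxtens exchange_big; apply: eq_bigr => t _.
by rewrite mxE; apply: eq_bigr => s _; rewrite !adjE !tvecE.
Qed.

Lemma fnorm_tvec k n (H : 'M[C]_(k, n)) : fnorm (tvec H) = fnorm H.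
Proof. by rewrite /fnorm /hs tvec_inner. Qed.

Lemma tens_tvec k' k n' n (K : 'M[C]_(k', k)) (X : 'M[C]_(n', n)) H :
  (K *t X) *m tvec H = tvec (K *m H *m X^T).
Proof.
apply/colP => i; case: (mxtens_indexP i) => s t.
rewrite tvecE !mxE sum_mxtens exchange_big; apply: eq_bigr => y _.
rewrite !mxE mulr_suml; apply: eq_bigr => x _.
by rewrite tensmxE tvecE mulrAC.
Qed.

(* The action of [L(X)] on vectors of C^k (x) C^n written as [k * n] matrices. *)
Definition pact g k' k (L : pencil R g k' k) n (X : 'I_g -> 'M[C]_n) (H : 'M[C]_(k, n)) :
    'M[C]_(k', n) :=
  \sum_j L j *m H *m (X j)^T.

Lemma mxeval_tvec g k' k (L : pencil R g k' k) n (X : 'I_g -> 'M[C]_n) H :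
  mxeval L X *m tvec H = tvec (pact L X H).
Proof.
rewrite /mxeval mulmx_suml; under eq_bigr do rewrite tens_tvec.
apply/colP => i; case: (mxtens_indexP i) => s t.
by rewrite tvecE !summxE; apply: eq_bigr => j _; rewrite tvecE.
Qed.

Lemma opnorm_pencil_ub g k' k (L : pencil R g k' k) n (X : 'I_g -> 'M[C]_n) H H' :
  Re (\tr (H'^t* *m pact L X H)) <= opnorm (mxeval L X) * (fnorm H * fnorm H').
Proof.
rewrite -tvec_inner -mxeval_tvec mulmxA -[fnorm H]fnorm_tvec -[fnorm H']fnorm_tvec.
exact: opnorm_trace_ub.
Qed.

Lemma opnorm_pencil_le g k' k (L : pencil R g k' k) n (X : 'I_g -> 'M[C]_n) (c : R) :
  0 <= c ->
  (forall H H', Re (\tr (H'^t* *m pact L X H)) <= c * (fnorm H * fnorm H')) ->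
  opnorm (mxeval L X) <= c.
Proof.
move=> c0 hL; apply: opnorm_trace_le => // U V.
have := hL (tmat V) (tmat U); rewrite -tvec_inner -mxeval_tvec !mulmxA.
by rewrite -fnorm_tvec -[fnorm (tmat U)]fnorm_tvec !tmatK.
Qed.

Lemma opnorm_pencil_le2 g k' k (L : pencil R g k' k) n (X : 'I_g -> 'M[C]_n) :
  (forall H H', Re (\tr (H'^t* *m pact L X H)) <= fnorm H ^+ 2 + fnorm H' ^+ 2) ->
  opnorm (mxeval L X) <= 2.
Proof.
move=> hL; apply: opnorm_le2 => // U V.
have := hL (tmat V) (tmat U); rewrite -tvec_inner -mxeval_tvec !mulmxA.
by rewrite -fnorm_tvec -[fnorm (tmat U)]fnorm_tvec !tmatK.
Qed.

End PencilAction.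

(** * Factorization of norm-dominated pencils *)

Section Factorization.
Variables (R : realType) (g : nat).
Local Notation C := R[i].

(* Pads the rectangular coefficients [Y j] to square ones, as evaluation requires. *)
Definition corner a a' (Y : 'I_g -> 'M[C]_(a, a')) (j : 'I_g) : 'M[C]_(a + a') :=
  block_mx 0 0 (Y j)^T 0.

Lemma trace_corner a a' k' k (Y : 'I_g -> 'M[C]_(a, a')) (L : pencil R g k' k) H H' :
  \tr (H'^t* *m pact L (corner Y) H) =
  \sum_j \tr (Y j *m ((rsubmx H')^t* *m L j *m lsubmx H)).
Proof.
rewrite /pact mulmx_sumr raddf_sum; apply: eq_bigr => j _ /=.
rewrite -{1}[H]hsubmxK -{1}[H']hsubmxK /corner tr_block_mx trmxK !trmx0.
rewrite -mulmxA mul_row_block !mulmx0 !addr0 mul_mx_row mulmx0.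
rewrite tr_row_mx map_col_mx mul_col_row mxtrace_block mulmx0 mxtrace0 add0r.
by rewrite !mulmxA mxtrace_mulC !mulmxA.
Qed.

Lemma fnorm_row_mx k m n (A : 'M[C]_(k, m)) (B : 'M[C]_(k, n)) :
  fnorm (row_mx A B) ^+ 2 = fnorm A ^+ 2 + fnorm B ^+ 2.
Proof.
rewrite !fnorm_sqr -ReD; congr Re.
by rewrite /hs tr_row_mx map_col_mx mul_col_row mxtrace_block.
Qed.

(** The separating multipliers are only semidefinite; a small multiple of the identity gives them
    invertible factors, which can then be absorbed into the test matrices. *)
Lemma psd_shift_factor n (P : 'M[C]_n) (e : R) : psd P -> 0 < e ->
  exists2 S : 'M[C]_n, S \in unitmx & P + e%:C%C%:M = S^t* *m S.
Proof.
move=> pP e0.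
have pe : psd (e%:C%C%:M : 'M[C]_n).
  exists n, (Num.sqrt e)%:C%C%:M.
  rewrite tr_scalar_mx map_scalar_mx -scalar_mxM /= conjC_realC -rmorphM.
  by rewrite -expr2 sqr_sqrtr // ltW.
have [S hS] := psd_sqrt (psdD pP pe); exists S => //.
suff : S^t* *m S \in unitmx by rewrite unitmx_mul => /andP[].
rewrite -hS -row_free_unit; apply: inj_row_free => v v0.
have v1 : ((v^t*)^t* *m P *m v^t*) 0 0 + e%:C%C * hs (v^t*) = 0.
  rewrite /hs /mxtrace big_ord1 trmxCK.
  move/(congr1 (fun u => (u *m v^t*) 0 0)): v0.
  rewrite mul0mx [RHS]mxE mulmxDr mulmxDl mxaddE => <-.
  by rewrite mul_mx_scalar -scalemxAl [X in _ = _ + X]mxE.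
have := v1; move/eqP; rewrite paddr_eq0 ?psd_form_ge0 //; last first.
  by rewrite mulr_ge0 ?hs_ge0 // ler0c ltW.
move=> /andP[_]; rewrite mulf_eq0 => /orP[/eqP/complexI e00|/eqP /hs_eq0 h].
  by rewrite e00 ltxx in e0.
by rewrite -[v]trmxCK h adj0.
Qed.

(** Allows a multiplier to be replaced by its Hermitian part, since it is only ever paired with
    Hermitian matrices. *)
Lemma Re_trace_herm n (rho G : 'M[C]_n) : G^t* = G ->
  Re (\tr (rho *m G)) = Re (\tr ((2^-1 : C) *: (rho + rho^t*) *m G)).
Proof.
move=> hG; rewrite -scalemxAl linearZ /= mulmxDl mxtraceD.
have -> : \tr (rho^t* *m G) = (\tr (rho *m G))^*.
  by rewrite -mxtrace_adj adjM hG mxtrace_mulC.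
have -> : (2^-1 : C) = (2^-1)%:C%C by rewrite fmorphV rmorph_nat.
by rewrite Re_real ReD cRe_conj; field.
Qed.

(** Otherwise separating data exist. Normalizing them by invertible factors of the shifted
    multipliers turns them into a point at which [K] has norm at most 2, while the strict inequality
    of the separation forces the norm of [A] there above 2. *)
Lemma crep_exists a' a k' k (A : pencil R g a' a) (K : pencil R g k' k) :
  (forall n (X : 'I_g -> 'M[C]_n), opnorm (mxeval A X) <= opnorm (mxeval K X)) ->
  exists (J : finType) W W', @crep R g a' a k' k A K J W W'.
Proof.
move=> normAK; have [//|[X [rho [rho' [sepK sepA]]]]] := crep_or_separated A K.
exfalso.
pose P := - ((2^-1 : C) *: (rho + rho^t*)).
pose P' := - ((2^-1 : C) *: (rho' + rho'^t*)).
have trP n (r G : 'M[C]_n) : G^t* = G ->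
    Re (\tr (r *m G)) = - Re (\tr (- ((2^-1 : C) *: (r + r^t*)) *m G)).
  by move=> hG; rewrite (Re_trace_herm _ hG) mulNmx raddfN ReN opprK.
have herm n (r : 'M[C]_n) :
    (- ((2^-1 : C) *: (r + r^t*)))^t* = - ((2^-1 : C) *: (r + r^t*)).
  rewrite -scaleNr adjZ adjD trmxCK addrC rmorphN fmorphV rmorph_nat.
  by rewrite scaleNr.
have psdP n (r : 'M[C]_n) : (forall v : 'cV[C]_n, Re (\tr (r *m (v *m v^t*))) <= 0) ->
    psd (- ((2^-1 : C) *: (r + r^t*))).
  move=> hr; suff [S ->] : exists S : 'M[C]_n, - ((2^-1 : C) *: (r + r^t*)) = S^t* *m S.
    exact: psd_gram.
  apply: psd_of_form (herm _ _) _ => v.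
  set z := (_ *m _ *m _) 0 0.
  have zE : z = \tr (- ((2^-1 : C) *: (r + r^t*)) *m (v *m v^t*)).
    by rewrite mulmxA mxtrace_mulC mulmxA /mxtrace big_ord1.
  have zr : z^* = z.
    by rewrite /z -adjE !adjM trmxCK herm mulmxA.
  have hv : (v *m v^t*)^t* = v *m v^t* by rewrite adjM trmxCK.
  have := hr v; rewrite (trP _ _ _ hv) -zE oppr_le0.
  have -> : z = (Re z)%:C%C.
    by move: zr; case: z {zE} => x y; rewrite conjCE => -[] /eqP; rewrite eqNr => /eqP ->.
  by rewrite ler0c.
(* Testing the separation on slack vectors alone shows that the negated Hermitian parts of the
   multipliers are positive. *)
have pP : psd P.
  apply: psdP => v; have := sepK 0 0 (v^t*) 0.
  rewrite trmxCK !mulmx0 !add0r !mulmx0 mxtrace0 addr0 big1 ?add0r //.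
  by move=> j _; rewrite !mulmx0 mxtrace0.
have pP' : psd P'.
  apply: psdP => v; have := sepK 0 0 0 (v^t*).
  rewrite trmxCK !mulmx0 !add0r mulmx0 mxtrace0 add0r big1 ?add0r //.
  by move=> j _; rewrite !mulmx0 mxtrace0.
pose gap := Re (\sum_j \tr (X j *m A j) + (\tr rho + \tr rho')).
(* The shift adds [e * (a + a')] to the total trace; the successor in the denominator keeps this
   strictly below the gap. *)
pose e := gap / (a + a').+1%:R.
have e0 : 0 < e by rewrite divr_gt0.
have egap : e * (a%:R + a'%:R) < gap.
  rewrite /e mulrAC ltr_pdivrMr // ltr_pM2l // -natrD ltr_nat //.
have [S uS hS] := psd_shift_factor pP e0.
have [S' uS' hS'] := psd_shift_factor pP' e0.
pose T := invmx S; pose T' := invmx S'.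
have ST : S *m T = 1%:M by exact: mulmxV.
have ST' : S' *m T' = 1%:M by exact: mulmxV.
have TS : T *m S = 1%:M by exact: mulVmx.
have TS' : T' *m S' = 1%:M by exact: mulVmx.
pose Y j := T^t* *m X j *m T'.
(* Substituting [B T^*] and [B' T'^*] bounds the multiplier terms by plain Frobenius norms, because
   [S T = 1] and [S' T' = 1]. *)
have sepY (B : 'M[C]_(k, a)) (B' : 'M[C]_(k', a')) :
    Re (\sum_j \tr (Y j *m (B'^t* *m K j *m B))) <= fnorm B ^+ 2 + fnorm B' ^+ 2.
  have := sepK (B *m T^t*) (B' *m T'^t*) 0 0.
  rewrite !mulmx0 !addr0.
  have -> : \sum_j \tr (X j *m ((B' *m T'^t*)^t* *m K j *m (B *m T^t*)))
      = \sum_j \tr (Y j *m (B'^t* *m K j *m B)).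
    apply: eq_bigr => j _; rewrite adjM trmxCK /Y !mulmxA mxtrace_mulC.
    by rewrite !mulmxA.
  have bound n m (r Z U : 'M[C]_n) (D : 'M[C]_(m, n))
      (Q := - ((2^-1 : C) *: (r + r^t*))) :
      Q + e%:C%C%:M = U^t* *m U -> U *m Z = 1%:M ->
      - (fnorm D ^+ 2) <= Re (\tr (r *m ((D *m Z^t*)^t* *m (D *m Z^t*)))).
    move=> QU UZ; rewrite trP ?adjM ?trmxCK ?mulmxA //.
    rewrite lerN2 fnorm_sqr.
    have -> : hs D = \tr ((Q + e%:C%C%:M) *m (Z *m D^t* *m D *m Z^t*)).
      rewrite QU -!mulmxA mxtrace_mulC -!mulmxA -adjM UZ adj1 mulmx1.
      by rewrite !mulmxA UZ mul1mx.
    rewrite mulmxDl mxtraceD ReD -!mulmxA -!/Q lerDl mul_scalar_mx linearZ /= Re_real.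
    rewrite mulr_ge0 ?(ltW e0) //.
    have := Re_ge0 (hs_ge0 (D *m Z^t*)).
    by rewrite /hs adjM trmxCK -!mulmxA.
  have b1 := bound _ _ rho T S B hS ST.
  have b2 := bound _ _ rho' T' S' B' hS' ST'.
  by rewrite !ReD; lra.
have normK : opnorm (mxeval K (corner Y)) <= 2.
  apply: opnorm_pencil_le2 => H H'; rewrite trace_corner.
  apply: le_trans (sepY _ _) _.
  rewrite -{2}[H]hsubmxK -{2}[H']hsubmxK !fnorm_row_mx.
  by have := sqr_ge0 (fnorm (rsubmx H)); have := sqr_ge0 (fnorm (lsubmx H')); lra.
have normA := le_trans (normAK _ (corner Y)) normK.
(* At these vectors the factors cancel against [T] and [T'], which restores the pairing of [X] with
   [A]; the squared norms are the traces of the shifted multipliers. *)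
have := opnorm_pencil_ub A (corner Y) (row_mx (S^t*) 0) (row_mx 0 (S'^t*)).
rewrite trace_corner row_mxKl row_mxKr trmxCK.
set nH := fnorm (row_mx _ 0); set nH' := fnorm (row_mx 0 _).
have reMn n : Re (e%:C%C *+ n) = e * n%:R by rewrite -rmorphMn /= mulr_natr.
have nH2 : nH ^+ 2 = - Re (\tr rho) + e * a%:R.
  rewrite /nH fnorm_row_mx fnorm0 expr0n addr0 fnorm_sqr hs_adj /hs -hS.
  rewrite mxtraceD ReD mxtrace_scalar -[\tr rho](congr1 _ (mulmx1 rho)).
  by rewrite trP ?adj1 // mulmx1 opprK reMn.
have nH2' : nH' ^+ 2 = - Re (\tr rho') + e * a'%:R.
  rewrite /nH' fnorm_row_mx fnorm0 expr0n add0r fnorm_sqr hs_adj /hs -hS'.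
  rewrite mxtraceD ReD mxtrace_scalar -[\tr rho'](congr1 _ (mulmx1 rho')).
  by rewrite trP ?adj1 // mulmx1 opprK reMn.
rewrite (eq_bigr (fun j => \tr (X j *m A j))) => [normXA|j _]; last first.
  rewrite /Y mxtrace_mulC !mulmxA.
  rewrite -[_ *m S^t* *m T^t*]mulmxA -adjM TS adj1 mulmx1 mxtrace_mulC !mulmxA.
  by rewrite TS' mul1mx mxtrace_mulC.
have nh0 : 0 <= nH * nH' by rewrite mulr_ge0 ?fnorm_ge0.
have : opnorm (mxeval A (corner Y)) * (nH * nH') <= 2 * (nH * nH').
  by rewrite ler_wpM2r.
have := sqr_ge0 (nH - nH'); rewrite sqrrB nH2 nH2'.
move: egap normXA; rewrite /gap !ReD; lra.
Qed.

End Factorization.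

(** * Minimal pencils *)

Lemma sum_CauchySchwarz (R : realType) (J : finType) (x y : J -> R) (a b : R) :
  0 <= a -> 0 <= b -> \sum_i x i ^+ 2 <= a ^+ 2 -> \sum_i y i ^+ 2 <= b ^+ 2 ->
  \sum_i x i * y i <= a * b.
Proof.
have vanish (u w : J -> R) : \sum_i u i ^+ 2 <= 0 -> \sum_i u i * w i = 0.
  move=> u0; have /eqP : \sum_i u i ^+ 2 = 0.
    by apply/le_anti; rewrite u0 sumr_ge0 // => i _; exact: sqr_ge0.
  rewrite psumr_eq0 => [/allP h|i _]; last exact: sqr_ge0.
  apply: big1 => i _; have := h i (mem_index_enum _).
  by rewrite /= sqrf_eq0 => /eqP ->; rewrite mul0r.
move=> a0 b0 xa yb.
have [az|an] := eqVneq a 0.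
  by rewrite az mul0r (vanish x y) // (le_trans xa) // az expr0n.
have [bz|bn] := eqVneq b 0.
  under eq_bigr do rewrite mulrC.
  by rewrite bz mulr0 (vanish y x) // (le_trans yb) // bz expr0n.
have ab : 0 < a * b by rewrite mulr_gt0 // lt_neqAle eq_sym ?an ?bn.
have : 2 * (a * b) * \sum_i x i * y i
    <= b ^+ 2 * \sum_i x i ^+ 2 + a ^+ 2 * \sum_i y i ^+ 2.
  rewrite !mulr_sumr -big_split; apply: ler_sum => i _ /=.
  by have := sqr_ge0 (b * x i - a * y i); rewrite -subr_ge0; nra.
have : b ^+ 2 * \sum_i x i ^+ 2 <= b ^+ 2 * a ^+ 2 by rewrite ler_wpM2l ?sqr_ge0.
have : a ^+ 2 * \sum_i y i ^+ 2 <= a ^+ 2 * b ^+ 2 by rewrite ler_wpM2l ?sqr_ge0.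
move=> h1 h2 h3; rewrite -(ler_pM2l ab); nra.
Qed.

Section PencilNorms.
Variables (R : realType) (g : nat).
Local Notation C := R[i].

(** The defect of the product family is the defect of the inner family plus the defect of the outer
    one conjugated by the inner operators, hence positive. *)
Lemma crep_comp a' a k' k l' l (A : pencil R g a' a) (K : pencil R g k' k)
    (L : pencil R g l' l) (J I : finType)
    (W : J -> 'M[C]_(k, a)) (W' : J -> 'M[C]_(k', a'))
    (V : I -> 'M[C]_(l, k)) (V' : I -> 'M[C]_(l', k')) :
  crep A K W W' -> crep K L V V' ->
  crep A L (fun p : J * I => V p.2 *m W p.1) (fun p => V' p.2 *m W' p.1).
Proof.
have psd_comp m n q (X : J -> 'M[C]_(n, m)) (Y : I -> 'M[C]_(q, n)) :
    psd (1%:M - \sum_i (X i)^t* *m X i) -> psd (1%:M - \sum_i (Y i)^t* *m Y i) ->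
    psd (1%:M - \sum_(p : J * I) (Y p.2 *m X p.1)^t* *m (Y p.2 *m X p.1)).
  move=> pX pY.
  suff -> : 1%:M - \sum_(p : J * I) (Y p.2 *m X p.1)^t* *m (Y p.2 *m X p.1)
    = 1%:M - \sum_i (X i)^t* *m X i
      + \sum_i (X i)^t* *m (1%:M - \sum_b (Y b)^t* *m Y b) *m X i.
    by apply: psdD => //; apply: psd_sum => i; exact: psd_conj.
  under [X in _ = _ + X]eq_bigr do rewrite mulmxBr mulmx1 mulmxBl.
  rewrite sumrB addrA subrK sum_pair /=; congr (_ - _); apply: eq_bigr => i _.
  rewrite mulmx_sumr mulmx_suml; apply: eq_bigr => b _.
  by rewrite adjM !mulmxA.
move=> [hA pW pW'] [hK pV pV']; split; [|exact: psd_comp|exact: psd_comp].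
move=> j; rewrite hA sum_pair; apply: eq_bigr => i _.
rewrite hK mulmx_sumr mulmx_suml; apply: eq_bigr => b _ /=.
by rewrite adjM !mulmxA.
Qed.

Definition adjp k' k (L : pencil R g k' k) : pencil R g k k' := fun j => (L j)^t*.

Lemma crep_adj a' a k' k (A : pencil R g a' a) (K : pencil R g k' k) (J : finType)
    (W : J -> 'M[C]_(k, a)) (W' : J -> 'M[C]_(k', a')) :
  crep A K W W' -> crep (adjp A) (adjp K) W' W.
Proof.
move=> [hA pW pW']; split=> // j; rewrite /adjp hA adj_sum.
by apply: eq_bigr => i _; rewrite !adjM trmxCK mulmxA.
Qed.

Lemma crep_fnorm a k (J : finType) (W : J -> 'M[C]_(k, a)) n (H : 'M[C]_(a, n)) :
  psd (1%:M - \sum_i (W i)^t* *m W i) ->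
  \sum_i fnorm (W i *m H) ^+ 2 <= fnorm H ^+ 2.
Proof.
move=> /(psd_conj H) /psd_trace_ge0 /Re_ge0.
rewrite mulmxBr mulmx1 mulmxBl raddfB /= ReB subr_ge0 -/(hs H) -fnorm_sqr.
apply: le_trans; rewrite mulmx_sumr mulmx_suml (raddf_sum (@mxtrace C n)). rewrite Re_sum.
by apply: ler_sum => i _; rewrite fnorm_sqr /hs adjM !mulmxA.
Qed.

(** Converse of [crep_exists]: each term is bounded by the norm of [K(X)], and the terms are summed
    by Cauchy-Schwarz using the two contraction conditions. *)
Lemma crep_opnorm a' a k' k (A : pencil R g a' a) (K : pencil R g k' k) (J : finType)
    (W : J -> 'M[C]_(k, a)) (W' : J -> 'M[C]_(k', a')) n (X : 'I_g -> 'M[C]_n) :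
  crep A K W W' -> opnorm (mxeval A X) <= opnorm (mxeval K X).
Proof.
move=> [hA pW pW']; apply: opnorm_pencil_le => [|H H']; first exact: opnorm_ge0.
have -> : \tr (H'^t* *m pact A X H)
    = \sum_i \tr ((W' i *m H')^t* *m pact K X (W i *m H)).
  rewrite -raddf_sum; congr (\tr _).
  under [RHS]eq_bigr do rewrite /pact mulmx_sumr.
  rewrite exchange_big /pact mulmx_sumr; apply: eq_bigr => j _ /=.
  rewrite hA mulmx_suml mulmx_suml mulmx_sumr; apply: eq_bigr => i _.
  by rewrite adjM !mulmxA.
rewrite Re_sum; apply: (@le_trans _ _
    (opnorm (mxeval K X) * \sum_i fnorm (W i *m H) * fnorm (W' i *m H'))).
  by rewrite mulr_sumr; apply: ler_sum => i _; exact: opnorm_pencil_ub.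
rewrite ler_wpM2l ?opnorm_ge0 //.
by apply: sum_CauchySchwarz; rewrite ?fnorm_ge0 ?crep_fnorm.
Qed.

Lemma mxevalZ k' k (L : pencil R g k' k) n (X : 'I_g -> 'M[C]_n) (c : C) :
  mxeval L (fun j => c *: X j) = c *: mxeval L X.
Proof.
rewrite /mxeval scaler_sumr; apply: eq_bigr => j _.
by apply/matrixP => s t; rewrite !mxE mulrCA.
Qed.

Lemma same_ball_le a' a k' k (A : pencil R g a' a) (K : pencil R g k' k) :
  same_ball A K -> forall n (X : 'I_g -> 'M[C]_n),
  opnorm (mxeval A X) <= opnorm (mxeval K X).
Proof.
move=> AK n X; rewrite leNgt; apply/negP => lt.
(* Dividing [X] by a number strictly between the two norms puts it in one ball and outside the
   other. *)
pose r := (opnorm (mxeval A X) + opnorm (mxeval K X)) / 2.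
have K0 := opnorm_ge0 (mxeval K X).
have r0 : 0 < r by rewrite /r; lra.
have ri : 0 < r^-1 by rewrite invr_gt0.
have : pencil_ball K n (fun j => r^-1%:C%C *: X j).
  rewrite /pencil_ball /= mxevalZ opnormZ // mulrC ltr_pdivrMr // mul1r /r.
  by move: lt; lra.
rewrite -AK /pencil_ball /= mxevalZ opnormZ // mulrC ltr_pdivrMr // mul1r /r.
by move: lt; lra.
Qed.

Lemma same_ball_sym a' a k' k (A : pencil R g a' a) (K : pencil R g k' k) :
  same_ball A K -> same_ball K A.
Proof. by move=> AK n; rewrite AK. Qed.

Lemma same_ball_opnorm a' a k' k (A : pencil R g a' a) (K : pencil R g k' k) :
  same_ball A K -> forall n (X : 'I_g -> 'M[C]_n),
  opnorm (mxeval A X) = opnorm (mxeval K X).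
Proof.
move=> AK n X; apply/le_anti/andP; split; apply: same_ball_le => //.
Qed.

Lemma opnorm_same_ball a' a k' k (A : pencil R g a' a) (K : pencil R g k' k) :
  (forall n (X : 'I_g -> 'M[C]_n), opnorm (mxeval A X) = opnorm (mxeval K X)) ->
  same_ball A K.
Proof.
by move=> AK n; apply: funext => X; rewrite /pencil_ball /= AK.
Qed.

Lemma opnorm_nondegenerate a' a k' k (A : pencil R g a' a) (K : pencil R g k' k) :
  (forall n (X : 'I_g -> 'M[C]_n), opnorm (mxeval A X) = opnorm (mxeval K X)) ->
  nondegenerate_pencil A -> nondegenerate_pencil K.
Proof.
move=> AK nA n X KX; apply: nA; apply: opnorm_eq0.
by rewrite AK KX opnorm0.
Qed.

Lemma opnorm_adj h k (A : 'M[C]_(h, k)) : opnorm (A^t*) = opnorm A.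
Proof.
have le h' k' (B : 'M[C]_(h', k')) : opnorm (B^t*) <= opnorm B.
  apply: opnorm_trace_le => [|U V]; first exact: opnorm_ge0.
  rewrite mulrC -cRe_conj -mxtrace_adj !adjM !trmxCK mulmxA mulrC [fnorm V * _]mulrC.
  exact: opnorm_trace_ub.
by apply/le_anti; rewrite le /=; have := le _ _ (A^t*); rewrite trmxCK.
Qed.

Lemma mxeval_adj k' k (L : pencil R g k' k) n (X : 'I_g -> 'M[C]_n) :
  mxeval (adjp L) X = (mxeval L (fun j => (X j)^t*))^t*.
Proof.
rewrite /mxeval adj_sum; apply: eq_bigr => j _.
apply/matrixP => s t; case: (mxtens_indexP s) => s1 s2; case: (mxtens_indexP t) => t1 t2.
by rewrite adjE !tensmxE rmorphM !adjE /= conjCK.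
Qed.

Lemma opnorm_mxeval_adj k' k (L : pencil R g k' k) n (X : 'I_g -> 'M[C]_n) :
  opnorm (mxeval (adjp L) X) = opnorm (mxeval L (fun j => (X j)^t*)).
Proof. by rewrite mxeval_adj opnorm_adj. Qed.

Lemma nondegenerate_adj k' k (L : pencil R g k' k) :
  nondegenerate_pencil L -> nondegenerate_pencil (adjp L).
Proof.
move=> nL n X /(congr1 (fun M => opnorm M)); rewrite opnorm_mxeval_adj opnorm0.
by move=> /opnorm_eq0 /nL X0 j; rewrite -[X j]trmxCK X0 adj0.
Qed.

Lemma minimal_adj p' p (Lt : pencil R g p' p) :
  minimal_pencil Lt -> minimal_pencil (adjp Lt).
Proof.
move=> [nLt minLt]; split; first exact: nondegenerate_adj.
move=> d' d L nL LLt; rewrite mulnC [X in (_ <= X)%N]mulnC.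
apply: (minLt _ _ (adjp L)); first exact: nondegenerate_adj.
apply: opnorm_same_ball => n X.
rewrite opnorm_mxeval_adj (same_ball_opnorm LLt) opnorm_mxeval_adj.
by congr (opnorm (mxeval _ _)); apply: funext => j; rewrite trmxCK.
Qed.

(** The adjoint of [E] is an orthonormal basis of the left kernel of [J], whose dimension is [l - p]
    because [J] has full column rank. *)
Lemma isometry_complement l p (J : 'M[C]_(l, p)) : J^t* *m J = 1%:M ->
  exists m (E : 'M[C]_(l, m)),
    [/\ (p + m)%N = l, E^t* *m E = 1%:M, J^t* *m E = 0 &
        J *m J^t* + E *m E^t* = 1%:M].
Proof.
move=> JJ.
have rJ : \rank J = p.
  apply/eqP; rewrite eqn_leq rank_leq_col /=.
  by rewrite -{1}[p](mxrank1 C) -JJ mxrankM_maxr.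
pose B := row_base (kermx J).
have rB : (\rank (kermx J) <= l)%N by exact: rank_leq_col.
pose N := schmidt B.
have NN : N *m N^t* = 1%:M by apply/unitarymxP; exact: schmidt_unitarymx.
have NJ : N *m J = 0.
  apply/eqP; rewrite -sub_kermx /N eqmx_schmidt_free ?row_base_free //.
  by rewrite eq_row_base.
have pl : (p + \rank (kermx J))%N = l.
  by rewrite mxrank_ker rJ subnKC // -rJ rank_leq_row.
have [m [N' [{}pl {}NN {}NJ]]] : exists m (N' : 'M[C]_(m, l)),
    [/\ (p + m)%N = l, N' *m N'^t* = 1%:M & N' *m J = 0].
  by exists (\rank (kermx J)), N.
clear rJ rB B N; subst l.
exists m, (N'^t*); rewrite trmxCK.
have JN : J^t* *m N'^t* = 0 by rewrite -adjM NJ adj0.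
split=> //.
(* A square matrix with orthonormal columns also has orthonormal rows, which yields the resolution
   of the identity. *)
have : (row_mx J (N'^t*))^t* *m row_mx J (N'^t*) = 1%:M.
  rewrite tr_row_mx map_col_mx mul_col_row JJ JN trmxCK NN NJ.
  by rewrite -scalar_mx_block.
move/mulmx1C.
by rewrite tr_row_mx map_col_mx mul_row_col trmxCK.
Qed.

Section Minimal.
Variables (p' p : nat) (Lt : pencil R g p' p).
Hypotheses (g_gt0 : (0 < g)%N) (minLt : minimal_pencil Lt).

(** With no rows every evaluation is the empty matrix, so nondegeneracy fails already at [X_j = 1].
    Positivity lets a drop in the number of columns lower the product of the sizes. *)
Let p'_gt0 : (0 < p')%N.
Proof.
rewrite lt0n; apply/negP => /eqP p0.
have := proj1 minLt 1%N (fun=> 1%:M) _ (Ordinal g_gt0).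
have -> : mxeval Lt (fun=> 1%:M : 'M_1) = 0.
  by apply/matrixP => -[i lt]; exfalso; move: lt; rewrite p0 mul0n ltn0.
move=> /(_ erefl) /matrixP /(_ 0 0) /eqP.
by rewrite !mxE eqxx oner_eq0.
Qed.

(* Otherwise [Lt] could be compressed to the orthogonal complement of [v]. *)
Lemma minimal_supported (J : finType) (Y : J -> 'M[C]_p) (Y' : J -> 'M[C]_p')
    (v : 'cV[C]_p) :
  crep Lt Lt Y Y' -> (forall i, (Y i)^t* *m v = 0) -> v = 0.
Proof.
move=> [hLt pY pY'] Yv; apply: fnorm_eq0; apply/eqP/negPn/negP => vn.
have v0 : 0 < fnorm v by rewrite lt_neqAle eq_sym vn fnorm_ge0.
pose u := (fnorm v)^-1%:C%C *: v.
have uu : u^t* *m u = 1%:M.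
  rewrite [LHS]mx11_scalar; congr _%:M.
  have -> : (u^t* *m u) 0 0 = hs u by rewrite /hs /mxtrace big_ord1.
  rewrite (ge0_realC (hs_ge0 u)) -fnorm_sqr fnormZ ger0_norm ?invr_ge0 ?fnorm_ge0 //.
  by rewrite mulVf // expr1n.
have [m [E [pm EE uE uuEE]]] := isometry_complement uu.
(* The ranges of all [Y i] are orthogonal to [u], so they lie in the range of [E]; hence [Lt] and
   its restriction [L1] represent each other. *)
have EY i : E *m (E^t* *m Y i) = Y i.
  have uY : u^t* *m Y i = 0.
    rewrite -[Y i]trmxCK -adjM -scalemxAr Yv scaler0 adj0; exact: erefl.
  by rewrite mulmxA -[RHS]mul1mx -uuEE mulmxDl -[u *m _ *m _]mulmxA uY mulmx0 add0r.
pose L1 : pencil R g p' m := fun j => Lt j *m E.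
have c1 : crep Lt L1 (fun i => E^t* *m Y i) Y'.
  split=> // [j|].
    by rewrite hLt; apply: eq_bigr => i _; rewrite /L1 -!mulmxA EY.
  under eq_bigr do rewrite adjM trmxCK -mulmxA EY.
  by [].
have c2 : crep L1 Lt (fun _ : 'I_1 => E) (fun _ : 'I_1 => 1%:M).
  split; last by rewrite big_ord1 adj1 mulmx1 subrr; exact: psd0.
    by move=> j; rewrite big_ord1 adj1 mul1mx.
  by rewrite big_ord1 EE subrr; exact: psd0.
have eqn n (X : 'I_g -> 'M[C]_n) : opnorm (mxeval Lt X) = opnorm (mxeval L1 X).
  by apply/le_anti; rewrite (crep_opnorm X c1) (crep_opnorm X c2).
have := proj2 minLt _ _ L1 (opnorm_nondegenerate eqn (proj1 minLt))
  (same_ball_sym (opnorm_same_ball eqn)).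
by rewrite leq_pmul2l // -pm add1n ltnn.
Qed.

End Minimal.

(** Expanding the squares of the defects [D i], the representation of [A j] turns both cross sums
    into [(A j)^* A j]. What remains is [A j] conjugating the positive matrix
    [1 - sum (W' i)^* W' i], which is dropped. *)
Lemma crep_schwarz a' a k' k (A : pencil R g a' a) (K : pencil R g k' k) (J : finType)
    (W : J -> 'M[C]_(k, a)) (W' : J -> 'M[C]_(k', a')) n (Z : 'M[C]_(a, n)) j :
  crep A K W W' ->
  hs (A j *m Z) + \sum_i hs ((K j *m W i - W' i *m A j) *m Z)
    <= \sum_i hs (K j *m W i *m Z).
Proof.
move=> [hA pW pW'].
pose D i := K j *m W i - W' i *m A j.
have e : \sum_i (K j *m W i)^t* *m (K j *m W i) =
    (A j)^t* *m A j + \sum_i (D i)^t* *m D i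
    + (A j)^t* *m (1%:M - \sum_i (W' i)^t* *m W' i) *m A j.
  have -> : \sum_i (D i)^t* *m D i = \sum_i (K j *m W i)^t* *m (K j *m W i)
      - (A j)^t* *m A j - (A j)^t* *m A j
      + (A j)^t* *m (\sum_i (W' i)^t* *m W' i) *m A j.
    have e1 : (A j)^t* *m A j = \sum_i (W' i *m A j)^t* *m (K j *m W i).
      rewrite {2}hA mulmx_sumr; apply: eq_bigr => i _.
      by rewrite adjM !mulmxA.
    have e2 : (A j)^t* *m A j = \sum_i (K j *m W i)^t* *m (W' i *m A j).
      move/(congr1 (fun M => M^t*)): e1; rewrite adjM trmxCK => ->.
      rewrite adj_sum; apply: eq_bigr => i _.
      by rewrite [LHS]adjM trmxCK.
    transitivity (\sum_i (K j *m W i)^t* *m (K j *m W i)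
        - \sum_i (W' i *m A j)^t* *m (K j *m W i)
        - \sum_i (K j *m W i)^t* *m (W' i *m A j)
        + \sum_i (W' i *m A j)^t* *m (W' i *m A j)).
      by rewrite -!sumrB -big_split; apply: eq_bigr => i _; exact: gram_sub.
    rewrite -e1 -e2 mulmx_sumr mulmx_suml; congr (_ + _).
    by apply: eq_bigr => i _; rewrite adjM !mulmxA.
  have z (V : zmodType) (x y u : V) : x = y + (x - y - y + u) + (y - u).
    rewrite -(addrA (x - y)) (_ : - y + u = - (y - u)); last by rewrite opprB addrC.
    by rewrite [y + _]addrA subrK addrC subrK.
  by rewrite mulmxBr mulmx1 mulmxBl; exact: z.
have e3 : \sum_i hs (K j *m W i *m Z) = hs (A j *m Z) + \sum_i hs (D i *m Z)
    + \tr (Z^t* *m ((A j)^t* *m (1%:M - \sum_i (W' i)^t* *m W' i) *m A j) *m Z).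
  have f m (B : 'M[C]_(m, a)) : hs (B *m Z) = \tr (Z^t* *m (B^t* *m B) *m Z).
    by rewrite /hs adjM !mulmxA.
  have fs m (I : finType) (B : I -> 'M[C]_(m, a)) :
      \sum_i hs (B i *m Z) = \tr (Z^t* *m (\sum_i (B i)^t* *m B i) *m Z).
    by rewrite mulmx_sumr mulmx_suml raddf_sum; apply: eq_bigr => i _; rewrite f.
  rewrite !fs f e -!mxtraceD -!mulmxDl -!mulmxDr; exact: erefl.
rewrite e3 lerDl psd_trace_ge0 //; do 2 apply: psd_conj; exact: pW'.
Qed.

Lemma term_le_sum (J : finType) (F : J -> C) i :
  (forall i, 0 <= F i) -> F i <= \sum_i F i.
Proof. by move=> F0; rewrite (bigD1 i) //= lerDl sumr_ge0. Qed.

Lemma crep_intertwines p' p k' k (Lt : pencil R g p' p) (K : pencil R g k' k)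
    (J I : finType) (W : J -> 'M[C]_(k, p)) (W' : J -> 'M[C]_(k', p'))
    (V : I -> 'M[C]_(p, k)) (V' : I -> 'M[C]_(p', k')) :
  (0 < g)%N -> minimal_pencil Lt -> crep Lt K W W' -> crep K Lt V V' ->
  forall i j, K j *m W i = W' i *m Lt j.
Proof.
move=> g0 minLt cW cV.
(* Any representation of [Lt] by itself will do; it only shows that the set over which [crep_max]
   maximizes is nonempty. *)
have [J0 [X0 [X0' cX]]] := @crep_exists _ _ _ _ _ _ Lt Lt (fun _ _ => lexx _).
have [JY [Y [Y' [cY maxY]]]] := crep_max cX.
pose D j i := K j *m W i - W' i *m Lt j.
have := maxY _ _ _ (crep_comp (crep_comp cY cW) cV).
(* The Schwarz inequality is applied to [W], keeping the defects, and then to [V], discarding them;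
   maximality leaves no room for the kept ones. *)
have le1 : \sum_x \sum_j hs (Lt j *m Y x) + \sum_x \sum_j \sum_i hs (D j i *m Y x)
   <= \sum_(q : JY * J * I) \sum_j hs (Lt j *m (V q.2 *m (W q.1.2 *m Y q.1.1))).
  rewrite sum_pair sum_pair -big_split; apply: ler_sum => x _ /=.
  under [leRHS]eq_bigr do rewrite exchange_big.
  rewrite [leRHS]exchange_big -big_split; apply: ler_sum => j _ /=.
  apply: le_trans (crep_schwarz (Y x) j cW) _; apply: ler_sum => i _.
  rewrite -mulmxA; apply: le_trans (_ : _ <= \sum_b hs (Lt j *m V b *m (W i *m Y x))) _.
    apply: le_trans (crep_schwarz (W i *m Y x) j cV).
    by rewrite lerDl sumr_ge0 // => b _; exact: hs_ge0.
  by apply: ler_sum => b _; rewrite -[Lt j *m V b *m _]mulmxA.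
move=> le2; have le3 := le_trans (ler_Re le1) le2.
have D0 x j i : D j i *m Y x = 0.
  apply: fnorm_eq0; apply/eqP; rewrite -sqrf_eq0 fnorm_sqr; apply/eqP/le_anti.
  rewrite Re_ge0 ?hs_ge0 // andbT.
  move: le3; rewrite ReD -[leRHS]addr0 lerD2l; apply: le_trans.
  have hsn q r s : 0 <= hs (D r s *m Y q) by exact: hs_ge0.
  apply: ler_Re.
  apply: le_trans (@term_le_sum _ (fun i => hs (D j i *m Y x)) i (hsn x j)) _.
  apply: le_trans (@term_le_sum _ (fun j => \sum_i hs (D j i *m Y x)) j _) _.
    by move=> r; apply: sumr_ge0.
  apply: (@term_le_sum _ (fun x => \sum_j \sum_i hs (D j i *m Y x)) x).
  by move=> q; apply: sumr_ge0 => r _; apply: sumr_ge0.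
move=> i j; apply/eqP; rewrite -subr_eq0 -/(D j i); apply/eqP.
(* [D Y = 0] makes each column of [D^*] orthogonal to the ranges of all [Y x], where
   [minimal_supported] applies. *)
have Dr s : (D j i)^t* *m delta_mx s (0 : 'I_1) = 0.
  apply: (minimal_supported g0 minLt cY) => x.
  by rewrite mulmxA -adjM D0 adj0 mul0mx.
apply/matrixP => s t; move/matrixP/(_ t 0): (Dr s).
by rewrite -colE !mxE => /eqP; rewrite conjC_eq0 => /eqP.
Qed.

End PencilNorms.

(** * Intertwiners *)

Section Support.
Variable C : numClosedFieldType.

Fact supp_key : unit. Proof. by []. Qed.

(* The orthogonal projection onto the range of [H]. *)
Definition supp n (H : 'M[C]_n) : 'M[C]_n :=
  locked_with supp_key (isqrt H *m H *m isqrt H).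

Lemma supp_def n (H : 'M[C]_n) : supp H = isqrt H *m H *m isqrt H.
Proof. by rewrite /supp unlock. Qed.

Lemma suppE n (H : 'M[C]_n) : psd H -> supp H = isqrt H *m isqrt H *m H.
Proof. by move=> pH; rewrite supp_def -mulmxA -(isqrt_comm pH) mulmxA. Qed.

Lemma suppK n (H : 'M[C]_n) : psd H -> supp H *m H = H.
Proof. by move=> pH; rewrite suppE // isqrtK. Qed.

Lemma supp_adj n (H : 'M[C]_n) : psd H -> (supp H)^t* = supp H.
Proof.
move=> pH; rewrite supp_def [LHS]adjM [(_ *m H)^t*]adjM (isqrt_adj pH) (psd_adj pH).
by rewrite mulmxA.
Qed.

Lemma Ksupp n (H : 'M[C]_n) : psd H -> H *m supp H = H.
Proof.
by move=> pH; rewrite -{1}(psd_adj pH) -(supp_adj pH) -adjM suppK // psd_adj.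
Qed.

Lemma supp_idem n (H : 'M[C]_n) : psd H -> supp H *m supp H = supp H.
Proof. by move=> pH; rewrite {1}suppE // -mulmxA Ksupp // suppE. Qed.

(** The Hilbert-Schmidt norm of [T - T E] expands into terms that cancel, since the projection [E]
    fixes [T^* T] on both sides. *)
Lemma mulmx_supp m n (T : 'M[C]_(m, n)) : T *m supp (T^t* *m T) = T.
Proof.
have pH := psd_gram T; set E := supp _.
apply/eqP; rewrite eq_sym -subr_eq0; apply/eqP/hs_eq0.
have KE : T^t* *m T *m E = T^t* *m T := Ksupp pH.
have EK : E *m (T^t* *m T) = T^t* *m T := suppK pH.
have Eh : E^t* = E := supp_adj pH.
rewrite /hs adjB adjM Eh mulmxBl !mulmxBr !mulmxA -[E *m T^t* *m T]mulmxA.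
by rewrite EK KE !subrr mxtrace0.
Qed.

End Support.

Section Intertwiners.
Variables (R : realType) (g : nat).
Local Notation C := R[i].

(** The second equation closes these pairs under adjoints, which brings [T^* T], its functional
    calculus and its support projection within reach. *)
Definition intertwines p' p k' k (Lt : pencil R g p' p) (K : pencil R g k' k)
    (T : 'M[C]_(k, p)) (T' : 'M[C]_(k', p')) : Prop :=
  forall j, K j *m T = T' *m Lt j /\ (K j)^t* *m T' = T *m (Lt j)^t*.

Lemma intertwines1 p' p (Lt : pencil R g p' p) : intertwines Lt Lt 1%:M 1%:M.
Proof. by move=> j; rewrite !mulmx1 !mul1mx. Qed.

Lemma intertwines0 p' p k' k (Lt : pencil R g p' p) (K : pencil R g k' k) :
  intertwines Lt K 0 0.
Proof. by move=> j; rewrite !mulmx0 !mul0mx. Qed.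

Lemma intertwinesD p' p k' k (Lt : pencil R g p' p) (K : pencil R g k' k) T T' S S' :
  intertwines Lt K T T' -> intertwines Lt K S S' -> intertwines Lt K (T + S) (T' + S').
Proof.
move=> iT iS j; have [T1 T2] := iT j; have [S1 S2] := iS j.
by rewrite !mulmxDr !mulmxDl T1 T2 S1 S2.
Qed.

Lemma intertwinesB p' p k' k (Lt : pencil R g p' p) (K : pencil R g k' k) T T' S S' :
  intertwines Lt K T T' -> intertwines Lt K S S' -> intertwines Lt K (T - S) (T' - S').
Proof.
move=> iT iS j; have [T1 T2] := iT j; have [S1 S2] := iS j.
by rewrite !mulmxBr !mulmxBl T1 T2 S1 S2.
Qed.

Lemma intertwinesM p' p k' k l' l (Lt : pencil R g p' p) (K : pencil R g k' k)
    (L : pencil R g l' l) T T' S S' :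
  intertwines Lt K S S' -> intertwines K L T T' ->
  intertwines Lt L (T *m S) (T' *m S').
Proof.
move=> iS iT j; have [T1 T2] := iT j; have [S1 S2] := iS j.
by rewrite !mulmxA T1 T2 -!mulmxA S1 S2 !mulmxA.
Qed.

Lemma intertwines_adj p' p k' k (Lt : pencil R g p' p) (K : pencil R g k' k) T T' :
  intertwines Lt K T T' -> intertwines K Lt (T^t*) (T'^t*).
Proof.
move=> iT j; have [T1 T2] := iT j.
split; last by rewrite -!adjM T1.
by move/(congr1 (fun M => M^t*)): T2; rewrite !adjM !trmxCK => <-.
Qed.

Lemma intertwines_isqrt p' p k' k (Lt : pencil R g p' p) (K : pencil R g k' k) T T' :
  intertwines Lt K T T' ->
  intertwines Lt Lt (isqrt (T^t* *m T)) (isqrt (T'^t* *m T')).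
Proof.
move=> iT j; have [H1 H2] := intertwinesM iT (intertwines_adj iT) j.
have pH := psd_gram T; have pH' := psd_gram T'.
by split; apply/esym; apply: isqrt_intertwine.
Qed.

Lemma intertwines_supp p' p k' k (Lt : pencil R g p' p) (K : pencil R g k' k) T T' :
  intertwines Lt K T T' ->
  intertwines Lt Lt (supp (T^t* *m T)) (supp (T'^t* *m T')).
Proof.
move=> iT; have iS := intertwines_isqrt iT.
have iH := intertwinesM iT (intertwines_adj iT).
by rewrite !supp_def; exact: (intertwinesM iS (intertwinesM iH iS)).
Qed.

Section Minimal.
Variables (p' p : nat) (Lt : pencil R g p' p).
Hypotheses (g_gt0 : (0 < g)%N) (minLt : minimal_pencil Lt).

(** The pair [1 - Q] and [1] alone represents [Lt] by itself, and the range of [Q] is orthogonal to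
    that of [1 - Q]. *)
Lemma minimal_projection_eq0 (Q : 'M[C]_p) :
  Q^t* = Q -> Q *m Q = Q -> (forall j, Lt j *m Q = 0) -> Q = 0.
Proof.
move=> hQ QQ LQ.
have c : crep Lt Lt (fun _ : 'I_1 => 1%:M - Q) (fun _ : 'I_1 => 1%:M).
  split; last by rewrite big_ord1 adj1 mulmx1 subrr; exact: psd0.
    by move=> j; rewrite big_ord1 adj1 mul1mx mulmxBr mulmx1 LQ subr0.
  rewrite big_ord1 adjB adj1 hQ mulmxBl mul1mx mulmxBr mulmx1 QQ subrr subr0.
  by rewrite opprB addrC subrK -QQ -{1}hQ; exact: psd_gram.
apply/matrixP => s t.
have /matrixP /(_ s 0) : Q *m delta_mx t (0 : 'I_1) = 0.
  apply: (minimal_supported g_gt0 minLt c) => _.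
  by rewrite adjB adj1 hQ mulmxA mulmxBl mul1mx QQ subrr mul0mx.
by rewrite -colE !mxE.
Qed.

(* With [V] the partial isometry in the polar decomposition of [D] and [E] its
   initial projection, [{1 - E, V}] represents [Lt] by compressions of itself
   that miss the range of [E]. *)
Lemma minimal_nilpotent_eq0 D D' :
  intertwines Lt Lt D D' -> D *m D = 0 -> D = 0.
Proof.
move=> iD DD; have iS := intertwines_isqrt iD; have iE := intertwines_supp iD.
have pH := psd_gram D; have pH' := psd_gram D'.
set H := D^t* *m D in iS iE pH; set H' := D'^t* *m D' in iS iE pH'.
set S := isqrt H in iS; set S' := isqrt H' in iS.
have VV n (B : 'M[C]_n) : (B *m isqrt (B^t* *m B))^t* *m (B *m isqrt (B^t* *m B))
    = supp (B^t* *m B).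
  by rewrite adjM (isqrt_adj (psd_gram B)) supp_def !mulmxA.
have iV := intertwinesM iS iD.
have iF := intertwinesB (intertwines1 Lt) iE.
have FF n (B : 'M[C]_n) : psd B ->
    (1%:M - supp B)^t* *m (1%:M - supp B) = 1%:M - supp B.
  move=> pB; rewrite adjB adj1 supp_adj // mulmxBl mul1mx mulmxBr mulmx1.
  by rewrite supp_idem // subrr subr0.
pose Y (b : bool) := if b then 1%:M - supp H else D *m S.
pose Y' (b : bool) := if b then 1%:M - supp H' else D' *m S'.
have c : crep Lt Lt Y Y'.
  split.
  - move=> j; rewrite big_bool /=.
    have [V1 _] := iV j; have [F1 _] := iF j.
    rewrite -[X in _ = X + _]mulmxA -[X in _ = _ + X]mulmxA V1 F1.
    rewrite [X in _ = X + _]mulmxA [X in _ = _ + X]mulmxA FF // VV -mulmxDl subrK.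
    by rewrite mul1mx.
  - by rewrite big_bool /= FF // VV subrK subrr; exact: psd0.
  - by rewrite big_bool /= FF // VV subrK subrr; exact: psd0.
(* Since [supp H] ends in [D^* D], nilpotency puts the range of [D], and with it that of the partial
   isometry, orthogonal to [supp H]. *)
have ED : supp H *m D = 0.
  by rewrite suppE // -mulmxA -[H *m D]mulmxA DD !mulmx0.
have E0 : supp H = 0.
  apply/matrixP => s t.
  have /matrixP /(_ s 0) : supp H *m delta_mx t (0 : 'I_1) = 0.
    apply: (minimal_supported g_gt0 minLt c) => -[] /=; rewrite mulmxA.
      by rewrite adjB adj1 supp_adj // mulmxBl mul1mx supp_idem // subrr mul0mx.
    rewrite adjM -[_ *m supp H]mulmxA -{1}(supp_adj pH) -adjM ED adj0.
    by rewrite mulmx0 mul0mx.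
  by rewrite -colE !mxE.
by rewrite -(mulmx_supp D) -/H E0 mulmx0.
Qed.

(** Injectivity is recorded as a full support projection, the form in which the polar part of [T] is
    seen to be an isometry. *)
Lemma injective_intertwiner k' k (K : pencil R g k' k) (J : finType) W W' :
  @crep R g p' p k' k Lt K J W W' -> (forall i, intertwines Lt K (W i) (W' i)) ->
  exists T T', intertwines Lt K T T' /\ supp (T^t* *m T) = 1%:M.
Proof.
move=> [hLt _ _] iW.
(* Induction on the rank deficiency [p - rank T], starting from the zero intertwiner. *)
suff H n T T' : intertwines Lt K T T' -> (p - \rank T < n)%N ->
    exists T T', intertwines Lt K T T' /\ supp (T^t* *m T) = 1%:M.
  by apply: (H _ _ _ (intertwines0 Lt K)); exact: ltnSn.
elim: n T T' => // n IHn T T' iT; rewrite ltnS => rT.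
pose Q := 1%:M - supp (T^t* *m T); have pH := psd_gram T.
have [Q0|Qn0] := eqVneq Q 0.
  by exists T, T'; split=> //; apply/esym/eqP; rewrite -subr_eq0; exact/eqP.
have hQ : Q^t* = Q by rewrite /Q adjB adj1 supp_adj.
have QQ : Q *m Q = Q.
  by rewrite /Q mulmxBl mul1mx mulmxBr mulmx1 supp_idem // subrr subr0.
have TQ : T *m Q = 0 by rewrite mulmxBr mulmx1 mulmx_supp subrr.
have [i WQ] : exists i, W i *m Q != 0.
  have [i Wi|WQ] := pickP (fun i => W i *m Q != 0); first by exists i.
  case/negP: Qn0; apply/eqP; apply: minimal_projection_eq0 => // j.
  rewrite hLt mulmx_suml big1 // => i _.
  by have /negbFE /eqP WQi := WQ i; rewrite -[LHS]mulmxA WQi mulmx0.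
pose S := W i *m Q; pose S' := W' i *m (1%:M - supp (T'^t* *m T')).
have iS : intertwines Lt K S S'.
  apply: intertwinesM (iW i).
  exact: intertwinesB (intertwines1 Lt) (intertwines_supp iT).
have TS : T^t* *m S = 0.
  apply: (minimal_nilpotent_eq0 (intertwinesM iS (intertwines_adj iT))).
  have QT : Q *m T^t* = 0 by rewrite -{1}hQ -adjM TQ adj0.
  by rewrite /S !mulmxA -[_ *m Q *m T^t*]mulmxA QT mulmx0 !mul0mx.
have lt : (\rank T < \rank (T + S)%R)%N.
  apply: rank_ltmx; rewrite ltmxE; apply/andP; split.
    (* As [T^* S = 0], multiplying [T + S] by the pseudo-inverse [(T^* T)^-1 T^*] and then by [T]
       recovers [T]. Equality of row spaces would make [T + S] vanish on [Q], where it equals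
       [S]. *)
    apply/submxP; exists (T *m (isqrt (T^t* *m T) *m isqrt (T^t* *m T) *m T^t*)).
    rewrite -[RHS]mulmxA -[X in _ = T *m X]mulmxA mulmxDr TS addr0.
    by rewrite -suppE // mulmx_supp.
  apply/negP => /submxP [Z hZ]; case/negP: WQ; apply/eqP.
  have : (T + S) *m Q = 0 by rewrite hZ -mulmxA TQ mulmx0.
  by rewrite mulmxDl TQ add0r /S -mulmxA QQ.
apply: (IHn _ _ (intertwinesD iT iS)); apply: leq_trans rT.
by rewrite ltn_sub2l // (leq_trans lt) // rank_leq_col.
Qed.

End Minimal.

Lemma isometric_intertwiner p' p k' k (Lt : pencil R g p' p) (K : pencil R g k' k) :
  (0 < g)%N -> minimal_pencil Lt ->
  (forall n (X : 'I_g -> 'M[C]_n), opnorm (mxeval K X) = opnorm (mxeval Lt X)) ->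
  exists J J', [/\ intertwines Lt K J J', J^t* *m J = 1%:M & J'^t* *m J' = 1%:M].
Proof.
move=> g0 minLt KLt.
have [I [W [W' cW]]] : exists (I : finType) W W', @crep R g p' p k' k Lt K I W W'.
  by apply: crep_exists => n X; rewrite KLt.
have [I' [V [V' cV]]] : exists (I : finType) V V', @crep R g k' k p' p K Lt I V V'.
  by apply: crep_exists => n X; rewrite KLt.
have iW i : intertwines Lt K (W i) (W' i).
  move=> j; split; first exact: crep_intertwines minLt cW cV i j.
  exact: (crep_intertwines g0 (minimal_adj minLt) (crep_adj cW) (crep_adj cV) i j).
have [T [T' [iT E1]]] := injective_intertwiner g0 minLt cW iW.
have pH := psd_gram T; have pH' := psd_gram T'.
(* Injectivity passes to [T']: on the kernel projection of [T'], [T (Lt j)^* = (K j)^* T'] vanishes,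
   hence so does [(Lt j)^*], and the adjoint pencil is minimal as well. *)
have E1' : supp (T'^t* *m T') = 1%:M.
  apply/eqP; rewrite eq_sym -subr_eq0; apply/eqP.
  apply: (minimal_projection_eq0 g0 (minimal_adj minLt)).
  - by rewrite adjB adj1 supp_adj.
  - by rewrite mulmxBl mul1mx mulmxBr mulmx1 supp_idem // subrr subr0.
  move=> j; have [_ T2] := iT j.
  have TL : T *m (adjp Lt j *m (1%:M - supp (T'^t* *m T'))) = 0.
    by rewrite mulmxA -T2 -mulmxA mulmxBr mulmx1 mulmx_supp subrr mulmx0.
  by rewrite -[LHS]mul1mx -E1 suppE // -!mulmxA TL !mulmx0.
exists (T *m isqrt (T^t* *m T)), (T' *m isqrt (T'^t* *m T')).
split; first exact: intertwinesM (intertwines_isqrt iT) iT.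
  by rewrite adjM isqrt_adj // !mulmxA -E1 supp_def !mulmxA.
by rewrite adjM isqrt_adj // !mulmxA -E1' supp_def !mulmxA.
Qed.

End Intertwiners.

(** * The direct summand *)

Section Amplification.
Variables (R : realType) (g : nat).
Local Notation C := R[i].

Lemma peval_delta d' d (L : pencil R g d' d) j : peval L (delta_mx 0 j) = L j.
Proof.
rewrite /peval (bigD1 j) //= mxE !eqxx scale1r big1 ?addr0 // => i ij.
by rewrite mxE (negPf ij) scale0r.
Qed.

Lemma nondegenerate_peval_eq0 d' d (L : pencil R g d' d) (x : 'rV[C]_g) :
  nondegenerate_pencil L -> peval L x = 0 -> x = 0.
Proof.
move=> nL Lx; have X0 := nL 1%N (fun j => (x 0 j)%:M) _.
apply/rowP => j; rewrite mxE.
have /matrixP /(_ 0 0) : (x 0 j)%:M = 0 :> 'M_1.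
  apply: X0; apply/matrixP => s t.
  case: (mxtens_indexP s) => s1 s2; case: (mxtens_indexP t) => t1 t2.
  move/matrixP/(_ s1 t1): Lx; rewrite /peval /mxeval !summxE [RHS]mxE => Lx.
  rewrite [RHS]mxE; apply: etrans Lx; apply: eq_bigr => i _.
  by rewrite tensmxE [_%:M _ _]mxE [RHS]mxE !ord1 eqxx mulr1n mulrC.
by rewrite !mxE eqxx.
Qed.

Lemma mxeval_sum d' d (L : pencil R g d' d) n (J : finType) (x : J -> 'rV[C]_g)
    (Y : J -> 'M[C]_n) :
  mxeval L (fun j => \sum_i x i 0 j *: Y i) = \sum_i peval L (x i) *t Y i.
Proof.
apply/matrixP => s t.
case: (mxtens_indexP s) => s1 s2; case: (mxtens_indexP t) => t1 t2.
rewrite /mxeval /peval !summxE; under eq_bigr do rewrite tensmxE summxE mulr_sumr.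
rewrite exchange_big; apply: eq_bigr => i _; rewrite tensmxE summxE mulr_suml.
by apply: eq_bigr => j _; rewrite !mxE mulrCA mulrA.
Qed.

Lemma ampl_sum d' d l' l (F : {vspace 'M[C]_(d', d)})
    (phi : {linear subvs_of F -> 'M[C]_(l', l)}) n (J : finType)
    (Z : J -> 'M[C]_(d' * n, d * n)) :
  ampl phi (\sum_i Z i) = \sum_i ampl phi (Z i).
Proof.
have lin := @ampl_is_linear R d' d l' l F phi n.
have a0 : ampl phi (0 : 'M[C]_(d' * n, d * n)) = 0.
  have := lin (-1) 0 0; rewrite scaler0 addr0 scaleN1r addNr; exact.
elim: (index_enum J) => [|j s IHs]; first by rewrite !big_nil.
by rewrite !big_cons -IHs -[Z j]scale1r lin !scale1r.
Qed.

Lemma rpeval_sum d' d (L : pencil R g d' d) (x : 'rV[C]_g) :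
  rpeval L x = \sum_j x 0 j *: rpeval L (delta_mx 0 j).
Proof.
apply: val_inj; rewrite /= raddf_sum /=.
by apply: eq_bigr => j _; rewrite peval_delta.
Qed.

(** The preimage is chosen by a linear pseudo-inverse, so that maps defined through it stay
    linear. *)
Definition range_preimage d' d (L : pencil R g d' d) (y : subvs_of (prange L)) :
    'rV[C]_g :=
  ((linfun (peval L))^-1)%VF (vsval y).

Lemma range_preimageK d' d (L : pencil R g d' d) (y : subvs_of (prange L)) :
  peval L (range_preimage y) = vsval y.
Proof. by rewrite -(lfunE (peval L)) limg_lfunVK // subvsP. Qed.

Section Image.
Variables (d' d l' l : nat) (L : pencil R g d' d).
Variable psi : {linear subvs_of (prange L) -> 'M[C]_(l', l)}.

Definition image_pencil : pencil R g l' l := fun j => psi (rpeval L (delta_mx 0 j)).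

Lemma image_pencilE x : psi (rpeval L x) = peval image_pencil x.
Proof.
rewrite rpeval_sum linear_sum; apply: eq_bigr => j _.
by rewrite linearZ.
Qed.

Lemma opnorm_image_pencil n (X : 'I_g -> 'M[C]_n) : completely_isometric psi ->
  opnorm (mxeval image_pencil X) = opnorm (mxeval L X).
Proof.
move=> iso.
have LX : mxeval L X = \sum_j vsval (rpeval L (delta_mx 0 j)) *t X j.
  by apply: eq_bigr => j _; rewrite /= peval_delta.
have <- : ampl psi (mxeval L X) = mxeval image_pencil X.
  by rewrite LX ampl_sum; apply: eq_bigr => j _; rewrite ampl_tens.
by apply: iso; exists g, (fun j => rpeval L (delta_mx 0 j)), X.
Qed.

End Image.

Section Compression.
Variables (p' p k' k m' m : nat) (Lt : pencil R g p' p) (K : pencil R g k' k).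
Variables (A : 'M[C]_(k', m')) (B : 'M[C]_(k, m)).

Definition compression (y : subvs_of (prange Lt)) : 'M[C]_(m', m) :=
  A^t* *m peval K (range_preimage y) *m B.

Lemma compression_is_linear : linear compression.
Proof.
move=> c y z; rewrite /compression /range_preimage !linearP /=.
by rewrite mulmxDl -scalemxAl.
Qed.

HB.instance Definition _ :=
  GRing.isLinear.Build C (subvs_of (prange Lt)) 'M[C]_(m', m) _ compression
    compression_is_linear.

(** The amplification of the map is evaluation of the pencil [A^* K B], which [K] represents with
    one term, and [K] has the same norms as [Lt]. *)
Lemma compression_contractive :
  (forall n (X : 'I_g -> 'M[C]_n), opnorm (mxeval K X) = opnorm (mxeval Lt X)) ->
  A^t* *m A = 1%:M -> B^t* *m B = 1%:M ->
  completely_contractive (compression : {linear _ -> _}).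
Proof.
move=> KLt AA BB n _ [q [e [Y ->]]].
(* Collecting coefficients by variable exhibits the given tensor as a value [Lt(X)]. *)
pose X j := \sum_i range_preimage (e i) 0 j *: Y i.
pose ABK : pencil R g m' m := fun j => A^t* *m K j *m B.
have -> : \sum_i vsval (e i) *t Y i = mxeval Lt X.
  rewrite mxeval_sum; apply: eq_bigr => i _.
  by rewrite range_preimageK.
have -> : ampl (compression : {linear _ -> _}) (mxeval Lt X) = mxeval ABK X.
  rewrite !mxeval_sum ampl_sum; apply: eq_bigr => i _.
  rewrite range_preimageK ampl_tens /= /compression /peval; congr (_ *t _).
  rewrite mulmx_sumr mulmx_suml; apply: eq_bigr => j _.
  by rewrite -scalemxAr -scalemxAl.
rewrite -KLt; apply: (@crep_opnorm _ _ _ _ _ _ _ _ 'I_1 (fun=> B) (fun=> A)).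
split=> [j||]; rewrite big_ord1 //.
  by rewrite BB subrr; exact: psd0.
by rewrite AA subrr; exact: psd0.
Qed.

End Compression.
End Amplification.

Theorem theorem1p5 (R : realType) (g d' d p' p l' l : nat) (hg : (0 < g)%N)
    (L : pencil R g d' d) (Lt : pencil R g p' p)
    (hL : nondegenerate_pencil L) (hLt : minimal_pencil_for L Lt)
    (psi : {linear subvs_of (prange L) -> 'M[R[i]]_(l', l)})
    (hpsi : completely_isometric psi) :
  exists (U : 'M[R[i]]_l') (V : 'M[R[i]]_l) (m' m : nat)
         (phi : {linear subvs_of (prange Lt) -> 'M[R[i]]_(m', m)})
         (el' : (p' + m')%N = l') (el : (p + m)%N = l),
    [/\ U \is unitarymx, V \is unitarymx, completely_contractive phi &
        forall x : 'rV[R[i]]_g,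
          psi (rpeval L x) =
          U *m castmx (el', el)
                 (block_mx (peval Lt x) 0 0 (phi (rpeval Lt x))) *m V^t*].
Proof.
have [minLt LtL] := hLt.
pose K := image_pencil psi.
have KLt n (X : 'I_g -> 'M[R[i]]_n) : opnorm (mxeval K X) = opnorm (mxeval Lt X).
  by rewrite (opnorm_image_pencil X hpsi) (same_ball_opnorm LtL).
have [J [J' [iJ JJ JJ']]] := isometric_intertwiner hg minLt KLt.
have [m [E [el EE JE JJEE]]] := isometry_complement JJ.
have [m' [E' [el' EE' JE' JJEE']]] := isometry_complement JJ'.
(* With the sizes identified, the cast in the conclusion becomes the identity. *)
subst l l'.
exists (row_mx J' E'), (row_mx J E), m', m.
exists (compression K E' E : {linear subvs_of (prange Lt) -> _}), erefl, erefl.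
split.
- by apply/unitarymxP; rewrite tr_row_mx map_col_mx mul_row_col.
- by apply/unitarymxP; rewrite tr_row_mx map_col_mx mul_row_col.
- exact: compression_contractive.
move=> x; rewrite castmx_id image_pencilE -/K /= /compression.
(* Nondegeneracy of [Lt] makes [peval Lt] injective, so the chosen preimage is the original
   vector. *)
have -> : range_preimage (rpeval Lt x) = x.
  apply/eqP; rewrite -subr_eq0; apply/eqP.
  apply: (nondegenerate_peval_eq0 (proj1 minLt)).
  by rewrite linearB /= range_preimageK subrr.
have KJ : peval K x *m J = J' *m peval Lt x.
  rewrite /peval mulmx_suml mulmx_sumr; apply: eq_bigr => j _.
  by rewrite -scalemxAl -scalemxAr (proj1 (iJ j)).
have JK : J'^t* *m peval K x = peval Lt x *m J^t*.
  rewrite /peval mulmx_suml mulmx_sumr; apply: eq_bigr => j _.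
  rewrite -scalemxAl -scalemxAr; congr (_ *: _).
  by rewrite -[LHS]trmxCK adjM trmxCK (proj2 (iJ j)) adjM !trmxCK.
rewrite tr_row_mx map_col_mx mul_row_block !mulmx0 addr0 add0r mul_row_col.
(* Both resolutions of the identity are inserted around [K]. The block from [E] to [J'] vanishes
   because [J'^* K E = Lt J^* E = 0]; the other off-diagonal block is absorbed by [K J = J' Lt]. *)
rewrite -KJ -[LHS]mulmx1 -JJEE mulmxDr !mulmxA; congr (_ + _ *m _).
rewrite -[in LHS](mul1mx (peval K x)) -JJEE' !mulmxDl.
by rewrite -[J' *m _ *m _]mulmxA JK -!mulmxA JE !mulmx0 add0r.
Qed.
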